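(* Let $N$ be a non-negative integer, $z$ be a positive real number, and let $\mu$ and $\nu$ be arbitrary real numbers such that $\mu+|\nu|<2N+1$. Then there is a number $\theta_N^{(S')}(z,\mu,\nu)$, depending on $z$, $\mu$, $\nu$ and $N$, with $0<\theta_N^{(S')}(z,\mu,\nu)<1$ and $$R_N^{(S')}(z,\mu,\nu)=(-1)^N\frac{b_N(-\mu,\nu)}{z^{2N}}\,\theta_N^{(S')}(z,\mu,\nu).$$
   Context: Lommel function: for complex $\mu,\nu$, $S_{\mu,\nu}(z)$ (analytic in $|\arg z|<\pi$) is the unique solution of $w''(z)+\frac1z w'(z)+\left(1-\frac{\nu^2}{z^2}\right)w(z)=z^{\mu-1}$ with $S_{\mu,\nu}(z)\sim z^{\mu-1}$ as $z\to\infty$ in $|\arg z|\le\pi-\delta$, for every fixed $\delta>0$. $S'_{\mu,\nu}$ is its derivative in $z$. Powers of $z$ are principal. Coefficients: $a_n(\mu,\nu)=\prod_{k=1}^n\left((\mu+2k-1)^2-\nu^2\right)$ (empty product is $1$) and $b_n(\mu,\nu)=-a_n(\mu,\nu)(\mu+2n+1)$, $n\ge0$. Remainder: for $|\arg z|<\pi$ and an integer $N\ge0$, $R_N^{(S')}(z,\mu,\nu)$ is defined by $$S'_{\mu,\nu}(z)=z^{\mu-2}\left(\sum_{n=0}^{N-1}(-1)^n\frac{b_n(-\mu,\nu)}{z^{2n}}+R_N^{(S')}(z,\mu,\nu)\right)$$ (empty sums are zero). *)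

(* Defs.v *)
From Stdlib Require Import Reals.
From Coquelicot Require Import Coquelicot.

Open Scope C_scope.

(** Principal argument, with values in ]-PI, PI]; the value at 0 is junk. *)
Definition Carg (z : C) : R :=
  if Rle_dec 0 (Im z) then acos (Re z / Cmod z) else Ropp (acos (Re z / Cmod z)).

Definition Cexp (z : C) : C :=
  (Rmult (exp (Re z)) (cos (Im z)), Rmult (exp (Re z)) (sin (Im z))).

Definition Clog (z : C) : C := (ln (Cmod z), Carg z).

(** Principal power [z ^ a], meaningful for [z <> 0]. *)
Definition Cppow (z a : C) : C := Cexp (a * Clog z).

Definition Cderivable (f : C -> C) (z : C) : Prop :=
  @ex_derive C_AbsRing C_NormedModule f z.

(** The domain |arg z| < PI, i.e. the plane cut along ]-oo, 0]. *)
Definition slit_plane (z : C) : Prop := z <> 0 /\ (Rabs (Carg z) < PI)%R.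

(** [f z ~ g z] as [z -> oo] in the sector |arg z| <= PI - delta, stated as
    [f z / g z -> 1]. *)
Definition sector_equiv (delta : R) (f g : C -> C) : Prop :=
  forall eps : R, (0 < eps)%R ->
  exists M : R, forall z : C,
    (M < Cmod z)%R -> (Rabs (Carg z) <= PI - delta)%R ->
    (Cmod (f z / g z - 1) < eps)%R.

(** [S] is the Lommel function S_{mu,nu}.  These conditions determine [S] on
    [slit_plane] only.  Analyticity is complex differentiability on the open
    set [slit_plane]; [C_derive] being total, differentiability of the first
    derivative is recorded separately. *)
Record is_LommelS (mu nu : C) (S : C -> C) : Prop := {
  LommelS_derivable : forall z, slit_plane z -> Cderivable S z;
  LommelS_derivable2 : forall z, slit_plane z -> Cderivable (C_derive S) z;
  LommelS_ode : forall z, slit_plane z ->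
    C_derive (C_derive S) z + 1 / z * C_derive S z
      + (1 - nu ^ 2 / z ^ 2) * S z = Cppow z (mu - 1);
  LommelS_asympt : forall delta : R, (0 < delta)%R ->
    sector_equiv delta S (fun z => Cppow z (mu - 1))
}.

(** a_n(mu, nu) = prod_(1 <= k <= n) ((mu + 2 k - 1)^2 - nu^2) *)
Fixpoint lommel_a (mu nu : C) (n : nat) : C :=
  match n with
  | O => 1
  | S m => lommel_a mu nu m * ((mu + 2 * INR n - 1) ^ 2 - nu ^ 2)
  end.

Definition lommel_b (mu nu : C) (n : nat) : C :=
  - lommel_a mu nu n * (mu + 2 * INR n + 1).

(** Sum of [f k] over [k < n]. *)
Fixpoint Csum (f : nat -> C) (n : nat) : C :=
  match n with
  | O => 0
  | S m => Csum f m + f m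
  end.

(** The remainder R_N^(S') (z, mu, nu), obtained by solving its defining
    equation, where [S] stands for S_{mu,nu}. *)
Definition LommelS'_rem (S : C -> C) (N : nat) (z mu nu : C) : C :=
  C_derive S z / Cppow z (mu - 2)
    - Csum (fun n => (-1) ^ n * (lommel_b (- mu) nu n / z ^ (2 * n))) N.

(* Main.v *)
(** Let [b = 2 N + 1 - mu > |nu|].  After [N + 1] terms, the remainder of the
    expansion of [S_{mu, nu}] solves the Lommel equation with a right-hand side
    proportional to [z ^ (- b - 2)].  So does an explicit integral: if [I] is the
    convolution of [cosh (nu t)] and [sinh^b t] on the half-line, then
    [H (z) = \int_0^oo exp (- z sinh t) I (t) dt] satisfies
    [H'' + H' / z + (1 - nu^2 / z^2) H = Gamma (b + 1) z ^ (- b - 2)].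

    On the half-plane [Re z > 0] the difference [h] of [S_{mu, nu}] and the
    candidate built from [H] is a solution of Bessel's equation bounded by a
    power of [z].  Along a vertical line [Re z = x] with [x] large, [q = |h|^2]
    satisfies [q'' >= q]; together with the polynomial bound this forces [q = 0].
    Hence [h] vanishes at all large real points, and then on the whole half-line.

    Differentiating, [theta = 1 - (b^2 - nu^2) J2 / (b J1)] where [J1] and [J2] are
    the integrals of [exp (- z sinh t)] against [cosh t sinh^b t] and
    [sinh t I (t)].  It is [< 1] because [b > |nu|], and [> 0] because of the pointwise
    inequality [(b^2 - nu^2) sinh t I (t) < b cosh t sinh^b t]. *)

Require Import Defs.
From Stdlib Require Import Reals Lra.
From Coquelicot Require Import Coquelicot.

Open Scope R_scope.

(** * Complex derivatives *)

(** The kernel explains both [I] and the variable [sinh t]. For [w = exp (- z sinh t)], the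
    expression [z^2 (w'' + w' / z + w)], with derivatives in [z], is the second derivative of [w] in
    [t]. Two integrations by parts move it to [I], which satisfies [I'' - nu^2 I = (sinh^b)'] and
    vanishes at 0 together with [I']; only the Laplace transform of a power is left.

    One term beyond [N] is taken out because [b] must be positive as an exponent of [sinh]: stopping
    at [N] terms would put [b - 2] in its place. That extra term also supplies the 1 in [theta].

    The obstacle is uniqueness. Along the real half-line every solution of Bessel's equation stays
    bounded at infinity, so growth there excludes nothing. Solutions behave like combinations of
    [exp (i z)] and [exp (- i z)], and on a vertical line any nonzero one grows exponentially in at
    least one direction. Hence the asymptotics in a sector, and complex powers and integrals, for a
    statement about real numbers. *)

Definition is_Cderive (f : C -> C) (z l : C) : Prop :=
  forall eps : R, 0 < eps -> exists delta : R, 0 < delta /\ forall w : C,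
    Cmod (w - z) < delta ->
    Cmod (f w - f z - (w - z) * l) <= eps * Cmod (w - z).

Lemma is_Cderive_equiv (f : C -> C) (z l : C) :
  @is_derive C_AbsRing C_NormedModule f z l <-> is_Cderive f z l.
Proof.
  split.
  - intros [_ H] eps He.
    destruct (H z (fun P HP => HP) (mkposreal eps He)) as [d Hd].
    exists d; split; [apply cond_pos|].
    intros w Hw. apply (Hd w). exact Hw.
  - intros H. split.
    + apply (@is_linear_scal_l C_AbsRing C_NormedModule l).
    + intros x Hx.
      rewrite <- (is_filter_lim_locally_unique _ _ Hx).
      intros eps. destruct (H eps (cond_pos eps)) as (d & Hd & Hw).
      exists (mkposreal d Hd). intros w Bw. apply Hw. exact Bw.
Qed.

Lemma Cderivable_is_Cderive (f : C -> C) (z : C) :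
  Cderivable f z -> is_Cderive f z (C_derive f z).
Proof. intros H. apply is_Cderive_equiv, C_derive_correct; trivial. Qed.

Lemma is_Cderive_ext (f g : C -> C) (z l : C) :
  (forall w, f w = g w) -> is_Cderive f z l -> is_Cderive g z l.
Proof.
  intros E H eps He. destruct (H eps He) as (d & Hd & K).
  exists d; split; trivial. intros w Hw. rewrite <- !E. auto.
Qed.

Lemma is_Cderive_const (c z : C) : is_Cderive (fun _ => c) z 0.
Proof. apply is_Cderive_equiv. exact (is_derive_const c z). Qed.

Lemma is_Cderive_plus (f g : C -> C) (z l m : C) :
  is_Cderive f z l -> is_Cderive g z m ->
  is_Cderive (fun w => f w + g w)%C z (l + m)%C.
Proof.
  intros Hf Hg. apply is_Cderive_equiv.
  apply (@is_derive_plus C_AbsRing C_NormedModule); now apply is_Cderive_equiv.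
Qed.

(** The product rule, and the inner function of the chain rule, take values in [C] as a module over
    itself, whereas [Cderivable] refers to [C_NormedModule]. The limit clauses of the two notions
    coincide. *)
Lemma is_Cderive_ring_equiv (f : C -> C) (z l : C) :
  @is_derive C_AbsRing (AbsRing_NormedModule C_AbsRing) f z l <-> is_Cderive f z l.
Proof.
  rewrite <- is_Cderive_equiv.
  split; intros [_ H]; split; try apply is_linear_scal_l; exact H.
Qed.

Lemma is_Cderive_mult (f g : C -> C) (z l m : C) :
  is_Cderive f z l -> is_Cderive g z m ->
  is_Cderive (fun w => f w * g w)%C z (l * g z + f z * m)%C.
Proof.
  intros Hf Hg. apply is_Cderive_ring_equiv.
  apply (@is_derive_mult C_AbsRing f g z l m).
  - now apply is_Cderive_ring_equiv.
  - now apply is_Cderive_ring_equiv.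
  - apply Cmult_comm.
Qed.

Lemma is_Cderive_comp (f g : C -> C) (z l m : C) :
  is_Cderive f (g z) l -> is_Cderive g z m ->
  is_Cderive (fun w => f (g w)) z (m * l)%C.
Proof.
  intros Hf Hg. apply is_Cderive_equiv.
  apply (@is_derive_comp C_AbsRing C_NormedModule f g z l m).
  - now apply is_Cderive_equiv.
  - now apply is_Cderive_ring_equiv.
Qed.

Lemma is_Cderive_scal (c : C) (f : C -> C) (z l : C) :
  is_Cderive f z l -> is_Cderive (fun w => c * f w)%C z (c * l)%C.
Proof.
  intros Hf. replace (c * l)%C with (0 * f z + c * l)%C by ring.
  apply is_Cderive_mult; trivial. apply is_Cderive_const.
Qed.

Lemma is_Cderive_minus (f g : C -> C) (z l m : C) :
  is_Cderive f z l -> is_Cderive g z m ->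
  is_Cderive (fun w => f w - g w)%C z (l - m)%C.
Proof.
  intros Hf Hg.
  apply is_Cderive_ext with (fun w => f w + (- 1) * g w)%C; [intros; ring|].
  replace (l - m)%C with (l + (- 1) * m)%C by ring.
  apply is_Cderive_plus; trivial. now apply is_Cderive_scal.
Qed.

Lemma is_Cderive_along_Re (f : C -> C) (z e l : C) (t : R) :
  is_Cderive f (z + t * e) l ->
  is_derive (fun t : R => Re (f (z + t * e)%C)) t (Re (e * l)) /\
  is_derive (fun t : R => Im (f (z + t * e)%C)) t (Im (e * l)).
Proof.
  intros H.
  (* [Re] and [Im] are handled at once: only compatibility with differences and real multiples and
     the bound by the modulus are used. *)
  assert (K : forall p : C -> R,
    (forall u v, p (u - v)%C = p u - p v) -> (forall (r : R) u, p (r * u)%C = r * p u) ->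
    (forall u, Rabs (p u) <= Cmod u) ->
    is_derive (fun t : R => p (f (z + t * e)%C)) t (p (e * l)%C)).
  { intros p Hm Hs Hb. split; [apply is_linear_scal_l|].
    intros x Hx. rewrite <- (is_filter_lim_locally_unique _ _ Hx).
    intros eps.
    pose (k := Cmod e + 1). assert (Hk : 0 < k) by (unfold k; generalize (Cmod_ge_0 e); lra).
    destruct (H (eps / k)) as (d & Hd & Hw).
    { apply Rdiv_lt_0_compat; [apply cond_pos|trivial]. }
    exists (mkposreal (d / k) (Rdiv_lt_0_compat _ _ Hd Hk)).
    intros y By. change (Rabs (y - t) < d / k) in By.
    assert (E : (z + y * e - (z + t * e) = RtoC (y - t) * e)%C)
      by (rewrite RtoC_minus; ring).
    assert (L : Cmod (z + y * e - (z + t * e))%C <= k * Rabs (y - t)).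
    { rewrite E, Cmod_mult, Cmod_R, Rmult_comm.
      apply Rmult_le_compat_r; [apply Rabs_pos|unfold k; lra]. }
    assert (L2 : Cmod (z + y * e - (z + t * e))%C < d).
    { apply Rle_lt_trans with (1 := L). apply Rmult_lt_compat_l with (1 := Hk) in By.
      replace (k * (d / k)) with d in By by (field; lra). exact By. }
    specialize (Hw _ L2).
    change (Rabs (p (f (z + y * e)%C) - p (f (z + t * e)%C) - (y - t) * p (e * l)%C)
      <= eps * Rabs (y - t)).
    rewrite <- Hs, <- !Hm. apply Rle_trans with (1 := Hb _).
    rewrite E in Hw. replace (RtoC (y - t) * (e * l))%C with (RtoC (y - t) * e * l)%C by ring.
    apply Rle_trans with (1 := Hw). rewrite <- E.
    apply Rle_trans with (eps / k * (k * Rabs (y - t))).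
    - apply Rmult_le_compat_l; trivial.
      apply Rlt_le, Rdiv_lt_0_compat; [apply cond_pos|trivial].
    - right. field. lra. }
  split.
  - apply (K Re).
    + intros [] []; reflexivity.
    + intros r []; unfold Re, Cmult; simpl; ring.
    + apply re_le_Cmod.
  - apply (K Im).
    + intros [] []; reflexivity.
    + intros r []; unfold Im, Cmult; simpl; ring.
    + intros u. eapply Rle_trans; [apply Rmax_r|apply Rmax_Cmod].
Qed.

(** The exponential, the logarithm and the Laplace transforms below all come with an explicit
    second-order error on a ball. *)
Lemma is_Cderive_quadratic (f : C -> C) (z l : C) (r M : R) : 0 < r ->
  (forall w, Cmod (w - z) < r ->
     Cmod (f w - f z - (w - z) * l) <= M * Cmod (w - z) ^ 2) ->
  is_Cderive f z l.
Proof.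
  intros Hr H eps He.
  assert (HM : 0 < Rabs M + 1) by (generalize (Rabs_pos M); lra).
  exists (Rmin r (eps / (Rabs M + 1))).
  split; [apply Rmin_pos; [trivial|now apply Rdiv_lt_0_compat]|].
  intros w Hw.
  apply Rle_trans with (1 := H w (Rlt_le_trans _ _ _ Hw (Rmin_l _ _))).
  assert (K := Rlt_le_trans _ _ _ Hw (Rmin_r _ _)).
  apply Rmult_lt_compat_l with (1 := HM) in K.
  replace ((Rabs M + 1) * (eps / (Rabs M + 1))) with eps in K by (field; lra).
  generalize (Rle_abs M) (Cmod_ge_0 (w - z)). nra.
Qed.

(** * Complex exponential, logarithm and powers *)

Lemma Cexp_plus (z w : C) : Cexp (z + w) = (Cexp z * Cexp w)%C.
Proof.
  destruct z as [a b], w as [c d].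
  unfold Cexp, Cplus, Cmult; simpl.
  rewrite exp_plus, cos_plus, sin_plus. f_equal; ring.
Qed.

Lemma Cexp_0 : Cexp 0 = 1.
Proof. unfold Cexp; simpl. rewrite exp_0, cos_0, sin_0. unfold RtoC. f_equal; ring. Qed.

Lemma Cmod_Cexp (z : C) : Cmod (Cexp z) = exp (Re z).
Proof.
  unfold Cmod, Cexp; simpl.
  replace (_ + _) with (Rsqr (exp (Re z)) * (Rsqr (sin (Im z)) + Rsqr (cos (Im z))))
    by (unfold Rsqr; ring).
  rewrite sin2_cos2, Rmult_1_r. apply sqrt_Rsqr, Rlt_le, exp_pos.
Qed.

Lemma Cexp_neq_0 (z : C) : Cexp z <> 0.
Proof. apply Cmod_gt_0. rewrite Cmod_Cexp. apply exp_pos. Qed.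

Lemma Rabs_MVT_0 (f df : R -> R) (b M : R) :
  (forall x, is_derive f x (df x)) ->
  (forall x, Rabs x <= Rabs b -> Rabs (df x) <= M) ->
  Rabs (f b - f 0) <= M * Rabs b.
Proof.
  intros Hd HM.
  destruct (MVT_gen f 0 b df) as (c & Hc & E).
  - intros; apply Hd.
  - intros x _. apply continuity_pt_filterlim, @ex_derive_continuous.
    exists (df x); apply Hd.
  - rewrite E, Rabs_mult, Rminus_0_r. apply Rmult_le_compat_r; [apply Rabs_pos|].
    apply HM. revert Hc. unfold Rmin, Rmax. destruct (Rle_dec 0 b); intros.
    + rewrite !Rabs_right; lra.
    + rewrite !Rabs_left1; lra.
Qed.

(** The bound is global on purpose: under the integral sign the increment is a multiple of [sinh t],
    which is unbounded. Each coordinate is split into products of one-variable quantities that are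
    jointly of second order. *)
Lemma Cmod_Cexp_taylor1 (w : C) :
  Cmod (Cexp w - 1 - w) <= 3 * Cmod w ^ 2 * exp (Cmod w).
Proof.
  destruct w as [a b].
  assert (Ha : Rabs a <= Cmod (a, b)) by (apply (re_le_Cmod (a, b))).
  assert (H2 : Cmod (a, b) ^ 2 = a ^ 2 + b ^ 2) by apply Cmod2_alt.
  set (m := Cmod (a, b)) in *.
  assert (Em : exp (Rabs a) <= exp m) by (destruct Ha as [Ha| ->]; [left; now apply exp_increasing|right; trivial]).
  assert (S0 : forall t, Rabs (sin t) <= Rabs t).
  { intros t. replace (sin t) with (sin t - sin 0) by (rewrite sin_0; ring).
    rewrite <- (Rmult_1_l (Rabs t)).
    apply Rabs_MVT_0 with cos; [intros; auto_derive; trivial; ring|].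
    intros x _. apply Rabs_le, COS_bound. }
  assert (C1 : forall t, Rabs (cos t - 1) <= Rabs t * Rabs t).
  { intros t. rewrite <- cos_0 at 1.
    apply Rabs_MVT_0 with (fun x => - sin x); [intros; auto_derive; trivial; ring|].
    intros x Hx. rewrite Rabs_Ropp. apply Rle_trans with (1 := S0 x), Hx. }
  assert (Sb : Rabs (sin b - b) <= Rabs b * Rabs b).
  { replace (sin b - b) with ((fun x => sin x - x) b - (fun x => sin x - x) 0)
      by (rewrite sin_0; ring).
    destruct (Rle_dec (Rabs b) 2) as [Hb|Hb].
    - apply (Rabs_MVT_0 (fun x => sin x - x) (fun x => cos x - 1)); [intros; auto_derive; trivial; ring|].
      intros x Hx. rewrite <- cos_0.
      rewrite <- (Rmult_1_l (Rabs b)).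
      apply Rle_trans with (1 * Rabs x); [|lra].
      apply Rabs_MVT_0 with (fun x => - sin x); [intros; auto_derive; trivial; ring|].
      intros y _. rewrite Rabs_Ropp. apply Rabs_le, SIN_bound.
    - rewrite sin_0. replace (sin b - b - (0 - 0)) with (sin b + - b) by ring.
      apply Rle_trans with (1 := Rabs_triang _ _). rewrite Rabs_Ropp.
      generalize (S0 b). nra. }
  assert (E1 : forall t, Rabs (exp t - 1) <= exp (Rabs t) * Rabs t).
  { intros t. rewrite <- exp_0 at 1.
    apply Rabs_MVT_0 with exp; [intros; auto_derive; trivial; ring|].
    intros x Hx. rewrite Rabs_pos_eq by (left; apply exp_pos).
    generalize (Rle_abs x); intros.
    destruct (Rle_lt_or_eq_dec x (Rabs t)) as [K|K]; [lra|left; now apply exp_increasing|rewrite K; lra]. }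
  assert (Ea : Rabs (exp a - 1 - a) <= exp (Rabs a) * Rabs a * Rabs a).
  { replace (exp a - 1 - a) with ((fun x => exp x - x) a - (fun x => exp x - x) 0)
      by (rewrite exp_0; ring).
    apply (Rabs_MVT_0 (fun x => exp x - x) (fun x => exp x - 1)); [intros; auto_derive; trivial; ring|].
    intros x Hx. apply Rle_trans with (1 := E1 x).
    apply Rmult_le_compat; trivial; try apply Rabs_pos; [left; apply exp_pos|].
    destruct Hx as [Hx| ->]; [left; now apply exp_increasing|right; trivial]. }
  assert (Eab : exp a <= exp (Rabs a)).
  { destruct (Rle_lt_or_eq_dec a (Rabs a) (Rle_abs a)) as [K|K];
      [left; now apply exp_increasing|rewrite <- K; lra]. }
  assert (P := exp_pos a).
  replace (Cexp (a, b) - 1 - (a, b))%C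
    with (((exp a - 1 - a) + exp a * (cos b - 1), exp a * (sin b - b) + (exp a - 1) * b) : C)
    by (unfold Cexp, Cminus, Cplus, Copp; simpl; f_equal; ring).
  set (X := exp a - 1 - a + _). set (Y := exp a * (sin b - b) + _).
  assert (Q : Cmod (X, Y) <= Rabs X + Rabs Y).
  { replace ((X, Y) : C) with (RtoC X + Ci * RtoC Y)%C
      by (unfold Ci, RtoC, Cplus, Cmult; simpl; f_equal; ring).
    apply Rle_trans with (1 := Cmod_triangle _ _).
    rewrite Cmod_mult, Cmod_Ci, !Cmod_R. lra. }
  apply Rle_trans with (1 := Q).
  assert (HX : Rabs X <= exp m * (Rabs a * Rabs a + Rabs b * Rabs b)).
  { unfold X. apply Rle_trans with (1 := Rabs_triang _ _).
    rewrite Rabs_mult, (Rabs_pos_eq (exp a)) by lra.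
    specialize (C1 b). generalize (Rabs_pos (cos b - 1)) (Rabs_pos a) (Rabs_pos b). intros.
    assert (exp a * Rabs (cos b - 1) <= exp m * (Rabs b * Rabs b)) by (apply Rmult_le_compat; lra).
    assert (exp (Rabs a) * (Rabs a * Rabs a) <= exp m * (Rabs a * Rabs a)) by (apply Rmult_le_compat_r; nra).
    lra. }
  assert (HY : Rabs Y <= exp m * (Rabs b * Rabs b + Rabs a * Rabs b)).
  { unfold Y. apply Rle_trans with (1 := Rabs_triang _ _).
    rewrite !Rabs_mult, (Rabs_pos_eq (exp a)) by lra.
    specialize (E1 a). generalize (Rabs_pos (sin b - b)) (Rabs_pos a) (Rabs_pos b). intros.
    assert (exp a * Rabs (sin b - b) <= exp m * (Rabs b * Rabs b)) by (apply Rmult_le_compat; lra).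
    assert (Rabs (exp a - 1) * Rabs b <= exp m * (Rabs a * Rabs b)).
    { apply Rle_trans with (exp (Rabs a) * Rabs a * Rabs b); [now apply Rmult_le_compat_r|].
      rewrite Rmult_assoc. apply Rmult_le_compat_r; nra. }
    lra. }
  rewrite H2. generalize (exp_pos m). intros.
  rewrite <- (pow2_abs a), <- (pow2_abs b).
  (* In total [a^2 + 2 b^2 + |a b|], at most [3 (a^2 + b^2)]; hence the constant 3. *)
  apply Rle_trans with (exp m * (Rabs a * Rabs a + Rabs b * Rabs b + (Rabs b * Rabs b + Rabs a * Rabs b)));
    [lra|].
  rewrite (Rmult_comm _ (exp m)). apply Rmult_le_compat_l; [lra|].
  generalize (pow2_ge_0 (Rabs a - Rabs b)) (pow2_ge_0 (Rabs a)) (pow2_ge_0 (Rabs b)). lra.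
Qed.

Lemma is_Cderive_Cexp (z : C) : is_Cderive Cexp z (Cexp z).
Proof.
  apply is_Cderive_quadratic with 1 (3 * exp 1 * Cmod (Cexp z)); [lra|].
  intros w Hw.
  replace (Cexp w - Cexp z - (w - z) * Cexp z)%C
    with (Cexp z * (Cexp (w - z) - 1 - (w - z)))%C.
  - rewrite Cmod_mult.
    generalize (Cmod_Cexp_taylor1 (w - z)). intros H.
    assert (exp (Cmod (w - z)) <= exp 1) by (left; now apply exp_increasing).
    assert (3 * Cmod (w - z) ^ 2 * exp (Cmod (w - z)) <= 3 * Cmod (w - z) ^ 2 * exp 1).
    { apply Rmult_le_compat_l; trivial. generalize (pow2_ge_0 (Cmod (w - z))). lra. }
    replace (3 * exp 1 * Cmod (Cexp z) * Cmod (w - z) ^ 2)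
      with (Cmod (Cexp z) * (3 * Cmod (w - z) ^ 2 * exp 1)) by ring.
    apply Rmult_le_compat_l; [apply Cmod_ge_0|lra].
  - replace (Cexp w) with (Cexp (z + (w - z))) by (f_equal; ring).
    rewrite Cexp_plus. ring.
Qed.

Lemma Re_pos_neq_0 (z : C) : 0 < Re z -> z <> 0.
Proof. intros H ->. simpl in H. lra. Qed.

(** This removes the case distinction on the sign of [Im z], which hides the smoothness of [Carg]
    across the positive real axis. *)
Lemma Carg_atan (z : C) : 0 < Re z -> Carg z = atan (Im z / Re z).
Proof.
  destruct z as [x y]. unfold Re, Im; simpl. intros Hx.
  assert (Hm : 0 < Cmod (x, y)) by (apply Cmod_gt_0, Re_pos_neq_0; exact Hx).
  assert (H2 : Cmod (x, y) ^ 2 = x ^ 2 + y ^ 2) by apply Cmod2_alt.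
  assert (Hle : x <= Cmod (x, y)).
  { apply Rle_trans with (Rabs x); [apply Rle_abs|apply (re_le_Cmod (x, y))]. }
  set (m := Cmod (x, y)) in *.
  assert (Hq : 0 < x / m <= 1).
  { split; [now apply Rdiv_lt_0_compat|]. apply Rmult_le_reg_r with m; trivial.
    unfold Rdiv. rewrite Rmult_assoc, Rinv_l; lra. }
  assert (A : acos (x / m) = atan (Rabs y / x)).
  { rewrite acos_atan by lra. f_equal.
    replace (1 - Rsqr (x / m)) with (Rsqr (y / m)).
    - rewrite sqrt_Rsqr_abs. unfold Rdiv. rewrite Rabs_mult, (Rabs_pos_eq (/ m)).
      + field. lra.
      + left; now apply Rinv_0_lt_compat.
    - unfold Rsqr. apply Rmult_eq_reg_r with (m ^ 2); [|nra].
      replace (y / m * (y / m) * m ^ 2) with (y ^ 2) by (field; lra).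
      replace ((1 - x / m * (x / m)) * m ^ 2) with (m ^ 2 - x ^ 2) by (field; lra). lra. }
  unfold Carg, Re, Im; simpl. fold m. rewrite A.
  destruct (Rle_dec 0 y) as [Hy|Hy].
  - rewrite Rabs_pos_eq; trivial.
  - rewrite Rabs_left1 by lra. rewrite <- atan_opp. f_equal. field. lra.
Qed.

Lemma Carg_bound (z : C) : 0 < Re z -> Rabs (Carg z) < PI / 2.
Proof. intros H. rewrite Carg_atan by trivial.
  generalize (atan_bound (Im z / Re z)). intros. apply Rabs_def1; lra. Qed.

Lemma Re_pos_slit_plane (z : C) : 0 < Re z -> slit_plane z.
Proof.
  intros H. split; [now apply Re_pos_neq_0|].
  generalize (Carg_bound z H) PI_RGT_0. lra.
Qed.

Lemma Cexp_Clog (z : C) : 0 < Re z -> Cexp (Clog z) = z.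
Proof.
  intros H. unfold Cexp, Clog; simpl. rewrite Carg_atan by trivial.
  assert (Hm : 0 < Cmod z) by now apply Cmod_gt_0, Re_pos_neq_0.
  destruct z as [x y]. unfold Re, Im in *; simpl in *.
  rewrite exp_ln by trivial. rewrite cos_atan, sin_atan.
  replace (sqrt (1 + (y / x)²)) with (Cmod (x, y) / x).
  - f_equal; field; lra.
  - symmetry. apply sqrt_lem_1.
    + unfold Rsqr. nra.
    + apply Rlt_le, Rdiv_lt_0_compat; lra.
    + replace (Cmod (x, y) / x * (Cmod (x, y) / x)) with (Cmod (x, y) ^ 2 / x ^ 2) by (field; lra).
      rewrite Cmod2_alt. unfold Re, Im, Rsqr; simpl. field. lra.
Qed.

(** A rough a priori bound, to be sharpened by inverting the exponential. On this ball the real part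
    stays above half of [Re z]. *)
Lemma Clog_lipschitz (z : C) : 0 < Re z -> exists K, 0 <= K /\
  forall w, Cmod (w - z) < Re z / 2 -> Cmod (Clog w - Clog z) <= K * Cmod (w - z).
Proof.
  destruct z as [x y]. unfold Re at 1 2; simpl. intros Hx.
  (* The first summand is for [ln] on moduli at least [x / 2]. The second is for the argument, by [v
     / u - y / x = ((v - y) x - y (u - x)) / (u x)] with [u > x / 2]. *)
  exists (2 / x + (x + Rabs y) * (2 / (x * x))).
  assert (P1 : 0 <= 2 / x) by (apply Rlt_le, Rdiv_lt_0_compat; lra).
  assert (P2 : 0 <= 2 / (x * x)) by (apply Rlt_le, Rdiv_lt_0_compat; nra).
  assert (Py := Rabs_pos y).
  split; [nra|].
  intros [u v] Hw.
  set (d := Cmod ((u, v) - (x, y))) in *.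
  assert (Du : Rabs (u - x) <= d) by apply (re_le_Cmod ((u, v) - (x, y))).
  assert (Dv : Rabs (v - y) <= d).
  { apply Rle_trans with (2 := Rmax_Cmod ((u, v) - (x, y))%C). apply Rmax_r. }
  assert (Hu : x / 2 < u) by (apply Rabs_le_between in Du; lra).
  assert (Pu : 0 < u) by lra.
  assert (Lz : x <= Cmod (x, y)) by (apply Rle_trans with (1 := Rle_abs x), (re_le_Cmod (x, y))).
  assert (Lw : u <= Cmod (u, v)) by (apply Rle_trans with (1 := Rle_abs u), (re_le_Cmod (u, v))).
  assert (Q : Cmod (Clog (u, v) - Clog (x, y)) <=
     Rabs (ln (Cmod (u, v)) - ln (Cmod (x, y))) + Rabs (Carg (u, v) - Carg (x, y))).
  { unfold Clog.
    replace ((ln (Cmod (u, v)), Carg (u, v)) - (ln (Cmod (x, y)), Carg (x, y)))%C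
      with (RtoC (ln (Cmod (u, v)) - ln (Cmod (x, y))) + Ci * RtoC (Carg (u, v) - Carg (x, y)))%C
      by (unfold Ci, RtoC, Cminus, Copp, Cplus, Cmult; simpl; f_equal; ring).
    apply Rle_trans with (1 := Cmod_triangle _ _).
    rewrite Cmod_mult, Cmod_Ci, !Cmod_R. lra. }
  apply Rle_trans with (1 := Q). rewrite Rmult_plus_distr_r.
  apply Rplus_le_compat.
  - destruct (MVT_gen ln (Cmod (x, y)) (Cmod (u, v)) (fun t => / t)) as (c & Hc & ->).
    + intros t Ht. apply is_derive_Reals, derivable_pt_lim_ln.
      revert Ht. unfold Rmin. destruct Rle_dec; lra.
    + intros t Ht. apply derivable_continuous_pt. exists (/ t). apply derivable_pt_lim_ln.
      revert Ht. unfold Rmin. destruct Rle_dec; lra.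
    + assert (x / 2 <= c) by (revert Hc; unfold Rmin; destruct Rle_dec; lra).
      rewrite Rabs_mult. apply Rmult_le_compat; try apply Rabs_pos.
      * rewrite Rabs_pos_eq by (left; apply Rinv_0_lt_compat; lra).
        replace (2 / x) with (/ (x / 2)) by (field; lra). apply Rinv_le_contravar; lra.
      * exact (norm_triangle_inv (V := C_NormedModule) (u, v) (x, y)).
  - rewrite !Carg_atan by trivial. unfold Re, Im; simpl.
    destruct (MVT_gen atan (y / x) (v / u) (fun t => / (1 + t ^ 2))) as (c & Hc & ->).
    + intros t Ht. apply is_derive_Reals. exact (derivable_pt_lim_atan t).
    + intros t Ht. apply derivable_continuous_pt, derivable_pt_atan.
    + rewrite Rabs_mult. apply Rle_trans with (1 * Rabs (v / u - y / x)).
      * apply Rmult_le_compat_r; [apply Rabs_pos|].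
        assert (0 < 1 + c ^ 2) by (generalize (pow2_ge_0 c); lra).
        rewrite Rabs_pos_eq by now left; apply Rinv_0_lt_compat.
        rewrite <- Rinv_1 at 2. apply Rinv_le_contravar; [lra|generalize (pow2_ge_0 c); lra].
      * rewrite Rmult_1_l.
        replace (v / u - y / x) with (((v - y) * x - y * (u - x)) * / (u * x)) by (field; lra).
        rewrite Rabs_mult. replace ((x + Rabs y) * (2 / (x * x)) * d)
          with ((x + Rabs y) * d * (2 / (x * x))) by ring.
        apply Rmult_le_compat; try apply Rabs_pos.
        -- apply Rle_trans with (Rabs (v - y) * x + Rabs y * Rabs (u - x)).
           ++ unfold Rminus at 1. apply Rle_trans with (1 := Rabs_triang _ _).
              rewrite Rabs_Ropp, !Rabs_mult, (Rabs_pos_eq x) by lra. lra.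
           ++ nra.
        -- rewrite Rabs_pos_eq by (left; apply Rinv_0_lt_compat; nra).
           replace (2 / (x * x)) with (/ (x / 2 * x)) by (field; lra).
           apply Rinv_le_contravar; nra.
Qed.

(** With [k = Clog w - Clog z] one has [w = z exp k], hence [k - (w - z) / z = - (exp k - 1 - k)].
    This is quadratic in [k] and, by the Lipschitz bound, in [w - z]. *)
Lemma is_Cderive_Clog (z : C) : 0 < Re z -> is_Cderive Clog z (/ z).
Proof.
  intros Hz. destruct (Clog_lipschitz z Hz) as (K & HK & L).
  assert (Hz0 := Re_pos_neq_0 z Hz).
  apply is_Cderive_quadratic with (Re z / 2) (3 * K ^ 2 * exp (K * Re z)); [lra|].
  intros w Hw. specialize (L w Hw).
  assert (Hw0 : 0 < Re w).
  { generalize (re_le_Cmod (w - z)). intros H.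
    destruct z as [x y], w as [u v]. unfold Re in *; simpl in *.
    assert (Rabs (u + - x) < x / 2) by lra. apply Rabs_def2 in H0. lra. }
  set (k := (Clog w - Clog z)%C) in *. set (d := Cmod (w - z)) in *.
  assert (E : w = (z * Cexp k)%C).
  { rewrite <- (Cexp_Clog z Hz) at 1. rewrite <- Cexp_plus.
    unfold k. replace (Clog z + (Clog w - Clog z))%C with (Clog w) by ring.
    now rewrite Cexp_Clog. }
  replace (k - (w - z) * / z)%C with (- (Cexp k - 1 - k))%C by (rewrite E; field; trivial).
  rewrite Cmod_opp. apply Rle_trans with (1 := Cmod_Cexp_taylor1 k).
  assert (Pk := Cmod_ge_0 k). assert (Pd : 0 <= d) by apply Cmod_ge_0.
  assert (exp (Cmod k) <= exp (K * Re z)).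
  { destruct (Rle_lt_or_eq_dec (Cmod k) (K * Re z)) as [H|H];
      [nra|left; now apply exp_increasing|rewrite H; lra]. }
  assert (Cmod k ^ 2 <= K ^ 2 * d ^ 2) by (rewrite <- Rpow_mult_distr; apply pow_incr; lra).
  replace (3 * K ^ 2 * exp (K * Re z) * d ^ 2) with (3 * (K ^ 2 * d ^ 2) * exp (K * Re z)) by ring.
  apply Rmult_le_compat; trivial; try (generalize (pow2_ge_0 (Cmod k)); lra).
  left; apply exp_pos.
Qed.

Lemma is_Cderive_Cppow (a z : C) : 0 < Re z ->
  is_Cderive (fun w => Cppow w a) z (a / z * Cppow z a)%C.
Proof.
  intros Hz. unfold Cppow, Cdiv.
  apply (is_Cderive_comp Cexp (fun w => a * Clog w)%C).
  - apply is_Cderive_Cexp.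
  - apply is_Cderive_scal. now apply is_Cderive_Clog.
Qed.

Lemma Cppow_plus (z a b : C) : Cppow z (a + b) = (Cppow z a * Cppow z b)%C.
Proof. unfold Cppow. rewrite <- Cexp_plus. f_equal. ring. Qed.

Lemma Cppow_1 (z : C) : 0 < Re z -> Cppow z 1 = z.
Proof. intros Hz. unfold Cppow. rewrite Cmult_1_l. now apply Cexp_Clog. Qed.

Lemma Cppow_neq_0 (z a : C) : Cppow z a <> 0.
Proof. apply Cexp_neq_0. Qed.

Lemma Cppow_minus_INR (z a : C) (n : nat) : 0 < Re z ->
  Cppow z (a - INR n) = (Cppow z a / z ^ n)%C.
Proof.
  intros Hz. assert (Hz0 := Re_pos_neq_0 z Hz). induction n as [|n IH].
  - simpl. replace (a - 0)%C with a by ring. field.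
  - rewrite S_INR, RtoC_plus.
    assert (H := Cppow_plus z (a - (INR n + 1)) 1).
    replace (a - (INR n + 1) + 1)%C with (a - INR n)%C in H by ring.
    rewrite IH, Cppow_1 in H by trivial. simpl.
    assert (z ^ n <> 0)%C by now apply Cpow_nz.
    apply (f_equal (fun t => t / z)%C) in H.
    replace (Cppow z (a - (INR n + 1)) * z / z)%C with (Cppow z (a - (INR n + 1))) in H by (field; trivial).
    rewrite <- H. field. split; trivial.
Qed.

Lemma Cmod_Cppow (z : C) (a : R) : Cmod (Cppow z a) = Rpower (Cmod z) a.
Proof. unfold Cppow. rewrite Cmod_Cexp. unfold Rpower. f_equal. simpl. ring. Qed.

Lemma Cppow_RtoC (x a : R) : 0 < x -> Cppow x a = RtoC (Rpower x a).
Proof.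
  intros Hx. unfold Cppow, Clog. rewrite Carg_atan by (simpl; trivial).
  simpl. unfold Rdiv. rewrite Rmult_0_l, atan_0, Cmod_R, Rabs_pos_eq by lra.
  unfold Cexp, Cmult; simpl. rewrite !Rmult_0_r, !Rmult_0_l, Rminus_0_r, Rplus_0_l, cos_0, sin_0.
  unfold Rpower, RtoC. f_equal; ring.
Qed.

(** * Integrals over the half-line *)

(** The rate [exp (- t)] is enough, since the kernel [exp (- x sinh t)] brings every function of
    exponential growth below a multiple of it. Continuity on the whole line avoids one-sided
    conditions at 0. *)
Definition exp_dominated (f : R -> R) : Prop :=
  (forall t, continuous f t) /\ exists K, forall t, 0 <= t -> Rabs (f t) <= K * exp (- t).

(* Total: meaningful when [f] is continuous and integrable at infinity. *)
Definition RInt_0oo (f : R -> R) : R := real (Lim_seq (fun n => RInt f 0 (INR n))).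

Lemma ex_RInt_all (f : R -> R) (a b : R) : (forall t, continuous f t) -> ex_RInt f a b.
Proof. intros H. apply (ex_RInt_continuous (V := R_CompleteNormedModule)). auto. Qed.

Lemma is_RInt_exp_opp (K a b : R) :
  is_RInt (fun t => K * exp (- t)) a b (K * (exp (- a) - exp (- b))).
Proof.
  replace (K * (exp (- a) - exp (- b))) with (minus (- K * exp (- b)) (- K * exp (- a)))
    by (unfold minus, plus, opp; simpl; ring).
  apply (is_RInt_derive (fun t => - K * exp (- t))).
  - intros x _. auto_derive; trivial. ring.
  - intros x _. apply (@ex_derive_continuous _ R_NormedModule). auto_derive. trivial.
Qed.

Lemma RInt_exp_dominated_le (f : R -> R) (K a b : R) : (forall t, continuous f t) ->
  (forall t, 0 <= t -> Rabs (f t) <= K * exp (- t)) -> 0 <= a <= b ->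
  Rabs (RInt f a b) <= K * (exp (- a) - exp (- b)).
Proof.
  intros Hc HK Hab.
  apply (norm_RInt_le f (fun t => K * exp (- t)) a b); [lra| | |apply is_RInt_exp_opp].
  - intros x Hx. apply HK. lra.
  - now apply (@RInt_correct R_CompleteNormedModule), ex_RInt_all.
Qed.

(** Adding [K (1 - exp (- n))], the integral of the dominating function, makes the sequence
    nondecreasing and bounded by [2 K]. The added sequence converges too and can be subtracted
    again. *)
Lemma is_lim_RInt_0oo (f : R -> R) : exp_dominated f ->
  is_lim_seq (fun n => RInt f 0 (INR n)) (RInt_0oo f).
Proof.
  intros [Hc [K HK]].
  apply Lim_seq_correct'.
  assert (PK : 0 <= K).
  { generalize (HK 0 (Rle_refl 0)) (Rabs_pos (f 0)). rewrite Ropp_0, exp_0. lra. }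
  assert (E : ex_finite_lim_seq (fun n => RInt f 0 (INR n) + K * (1 - exp (- INR n)))).
  { apply ex_finite_lim_seq_incr with (2 * K).
    - intros n. rewrite <- (RInt_Chasles f 0 (INR n) (INR (S n))) by now apply ex_RInt_all.
      assert (H := RInt_exp_dominated_le f K (INR n) (INR (S n)) Hc HK).
      rewrite S_INR in *. generalize (pos_INR n). intros.
      apply Rabs_le_between in H; [|lra]. unfold plus; simpl. lra.
    - intros n. assert (H := RInt_exp_dominated_le f K 0 (INR n) Hc HK).
      generalize (pos_INR n) (exp_pos (- INR n)). intros.
      rewrite Ropp_0, exp_0 in H. apply Rabs_le_between in H; [|lra]. nra. }
  destruct E as [l Hl].
  exists (l - K * (1 - 0)).
  apply is_lim_seq_ext with
    (fun n => (RInt f 0 (INR n) + K * (1 - exp (- INR n))) - K * (1 - exp (- INR n))).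
  { intros; ring. }
  apply is_lim_seq_minus'; trivial.
  apply (is_lim_seq_scal_l _ K (1 - 0)).
  apply is_lim_seq_minus'; [apply is_lim_seq_const|].
  apply (is_lim_comp_seq exp (fun n => - INR n) m_infty 0).
  - apply is_lim_exp_m.
  - exists 0%nat. intros n _. discriminate.
  - apply (is_lim_seq_opp INR p_infty), is_lim_seq_INR.
Qed.

Lemma RInt_0oo_unique (f : R -> R) (l : R) :
  is_lim_seq (fun n => RInt f 0 (INR n)) l -> RInt_0oo f = l.
Proof. intros H. unfold RInt_0oo. now rewrite (is_lim_seq_unique _ _ H). Qed.

Lemma RInt_0oo_ext (f g : R -> R) :
  (forall t, f t = g t) -> RInt_0oo f = RInt_0oo g.
Proof.
  intros H. unfold RInt_0oo. f_equal. apply Lim_seq_ext. intros n.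
  apply RInt_ext. auto.
Qed.

Lemma exp_dominated_plus (f g : R -> R) :
  exp_dominated f -> exp_dominated g -> exp_dominated (fun t => f t + g t).
Proof.
  intros [Cf [K HK]] [Cg [L HL]]. split.
  - intros t. now apply (continuous_plus (V := R_NormedModule) f g).
  - exists (K + L). intros t Ht. apply Rle_trans with (1 := Rabs_triang _ _).
    specialize (HK t Ht). specialize (HL t Ht). lra.
Qed.

Lemma exp_dominated_scal (c : R) (f : R -> R) :
  exp_dominated f -> exp_dominated (fun t => c * f t).
Proof.
  intros [Cf [K HK]]. split.
  - intros t. now apply (continuous_scal_r (V := R_NormedModule) c f).
  - exists (Rabs c * K). intros t Ht. rewrite Rabs_mult, Rmult_assoc.
    apply Rmult_le_compat_l; [apply Rabs_pos|auto].
Qed.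

Lemma RInt_0oo_plus (f g : R -> R) : exp_dominated f -> exp_dominated g ->
  RInt_0oo (fun t => f t + g t) = RInt_0oo f + RInt_0oo g.
Proof.
  intros Hf Hg. apply RInt_0oo_unique.
  apply is_lim_seq_ext with (fun n => RInt f 0 (INR n) + RInt g 0 (INR n)).
  - intros n. symmetry. apply (RInt_plus f g); apply ex_RInt_all; [apply Hf|apply Hg].
  - apply is_lim_seq_plus'; now apply is_lim_RInt_0oo.
Qed.

Lemma RInt_0oo_scal (c : R) (f : R -> R) : exp_dominated f ->
  RInt_0oo (fun t => c * f t) = c * RInt_0oo f.
Proof.
  intros Hf. apply RInt_0oo_unique.
  apply is_lim_seq_ext with (fun n => c * RInt f 0 (INR n)).
  - intros n. symmetry. apply (RInt_scal (V := R_CompleteNormedModule) f); apply ex_RInt_all, Hf.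
  - apply (is_lim_seq_scal_l _ c (RInt_0oo f)). now apply is_lim_RInt_0oo.
Qed.

Lemma RInt_0oo_le_const (f : R -> R) (K : R) : (forall t, continuous f t) ->
  (forall t, 0 <= t -> Rabs (f t) <= K * exp (- t)) -> Rabs (RInt_0oo f) <= K.
Proof.
  intros Hc HK.
  assert (L : is_lim_seq (fun n => RInt f 0 (INR n)) (RInt_0oo f))
    by (apply is_lim_RInt_0oo; split; [trivial|now exists K]).
  apply is_lim_seq_abs in L.
  apply (is_lim_seq_le _ (fun _ => K) _ K) with (2 := L); [|apply is_lim_seq_const].
  intros n. apply Rle_trans with (1 := RInt_exp_dominated_le f K 0 (INR n) Hc HK (conj (Rle_refl 0) (pos_INR n))).
  assert (PK : 0 <= K).
  { generalize (HK 0 (Rle_refl 0)) (Rabs_pos (f 0)). rewrite Ropp_0, exp_0. lra. }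
  rewrite Ropp_0, exp_0. generalize (exp_pos (- INR n)). nra.
Qed.

Lemma RInt_0oo_gt_0 (f : R -> R) : exp_dominated f ->
  (forall t, 0 < t -> 0 < f t) -> 0 < RInt_0oo f.
Proof.
  intros Hf Hp.
  apply Rlt_le_trans with (RInt f 0 1).
  - apply RInt_gt_0; [lra|intros; apply Hp; lra|intros; apply Hf].
  - apply (is_lim_seq_le_loc (fun _ => RInt f 0 1) _ (RInt f 0 1) (RInt_0oo f)) with (2 := is_lim_seq_const _) (3 := is_lim_RInt_0oo f Hf).
    exists 1%nat. intros n Hn. apply le_INR in Hn. simpl in Hn.
    rewrite <- (RInt_Chasles f 0 1 (INR n)) by apply ex_RInt_all, Hf.
    assert (0 <= RInt f 1 (INR n)).
    { apply RInt_ge_0; trivial; [apply ex_RInt_all, Hf|]. intros x Hx. left. apply Hp. lra. }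
    unfold plus; simpl. lra.
Qed.

Lemma RInt_0oo_derive (F f : R -> R) : (forall t, is_derive F t (f t)) ->
  (forall t, continuous f t) -> (exists K, forall t, 0 <= t -> Rabs (F t) <= K * exp (- t)) ->
  RInt_0oo f = - F 0.
Proof.
  intros HF Hc [K HK]. apply RInt_0oo_unique.
  apply is_lim_seq_ext with (fun n => F (INR n) - F 0).
  - intros n. symmetry. apply is_RInt_unique.
    apply (is_RInt_derive F f); auto.
  - replace (- F 0) with (0 - F 0) by ring.
    apply is_lim_seq_minus'; [|apply is_lim_seq_const].
    apply is_lim_seq_abs_0.
    apply (is_lim_seq_le_le (fun _ => 0) _ (fun n => K * exp (- INR n))).
    + intros n. split; [apply Rabs_pos|apply HK, pos_INR].
    + apply is_lim_seq_const.
    + replace (Finite 0) with (Rbar_mult K 0) by (simpl; f_equal; ring).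
      apply is_lim_seq_scal_l.
      apply (is_lim_comp_seq exp (fun n => - INR n) m_infty 0).
      * apply is_lim_exp_m.
      * exists 0%nat. intros n _. discriminate.
      * apply (is_lim_seq_opp INR p_infty), is_lim_seq_INR.
Qed.

Definition Cexp_dominated (f : R -> C) : Prop :=
  exp_dominated (fun t => Re (f t)) /\ exp_dominated (fun t => Im (f t)).

Definition CInt_0oo (f : R -> C) : C :=
  (RInt_0oo (fun t => Re (f t)), RInt_0oo (fun t => Im (f t))).

Lemma CInt_0oo_ext (f g : R -> C) : (forall t, f t = g t) -> CInt_0oo f = CInt_0oo g.
Proof. intros H. unfold CInt_0oo. f_equal; apply RInt_0oo_ext; intros; now rewrite H. Qed.

Lemma CInt_0oo_plus (f g : R -> C) : Cexp_dominated f -> Cexp_dominated g ->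
  CInt_0oo (fun t => f t + g t)%C = (CInt_0oo f + CInt_0oo g)%C.
Proof.
  intros [F1 F2] [G1 G2]. unfold CInt_0oo, Cplus at 3. simpl.
  f_equal; rewrite <- RInt_0oo_plus; trivial.
Qed.

Lemma CInt_0oo_scal (c : C) (f : R -> C) : Cexp_dominated f ->
  CInt_0oo (fun t => c * f t)%C = (c * CInt_0oo f)%C.
Proof.
  intros [F1 F2]. destruct c as [a b]. unfold CInt_0oo, Cmult at 3. simpl. f_equal.
  - replace (a * RInt_0oo (fun t => Re (f t)) - b * RInt_0oo (fun t => Im (f t)))
      with (a * RInt_0oo (fun t => Re (f t)) + (- b) * RInt_0oo (fun t => Im (f t))) by ring.
    rewrite <- !RInt_0oo_scal, <- RInt_0oo_plus by (trivial; now apply exp_dominated_scal).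
    apply RInt_0oo_ext. intros t. unfold Re, Im; simpl. ring.
  - rewrite <- !RInt_0oo_scal, <- RInt_0oo_plus by (trivial; now apply exp_dominated_scal).
    apply RInt_0oo_ext. intros t. unfold Re, Im; simpl. ring.
Qed.

Lemma Cexp_dominated_plus (f g : R -> C) :
  Cexp_dominated f -> Cexp_dominated g -> Cexp_dominated (fun t => f t + g t)%C.
Proof. intros [F1 F2] [G1 G2]. split; now apply exp_dominated_plus. Qed.

Lemma exp_dominated_ext (f g : R -> R) :
  (forall t, f t = g t) -> exp_dominated f -> exp_dominated g.
Proof.
  intros E [Hc [K HK]]. split.
  - intros t. apply (continuous_ext f); trivial.
  - exists K. intros. rewrite <- E. auto.
Qed.

Lemma Cexp_dominated_scal (c : C) (f : R -> C) :
  Cexp_dominated f -> Cexp_dominated (fun t => c * f t)%C.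
Proof.
  intros [F1 F2]. destruct c as [a b]. split.
  - apply exp_dominated_ext with (fun t => a * Re (f t) + (- b) * Im (f t)).
    + intros t. unfold Re, Im; simpl. ring.
    + apply exp_dominated_plus; now apply exp_dominated_scal.
  - apply exp_dominated_ext with (fun t => a * Im (f t) + b * Re (f t)).
    + intros t. unfold Re, Im; simpl. ring.
    + apply exp_dominated_plus; now apply exp_dominated_scal.
Qed.

Lemma Cmod_le_Re_Im (z : C) : Cmod z <= Rabs (Re z) + Rabs (Im z).
Proof.
  destruct z as [a b].
  assert (E : (a, b) = (RtoC a + Ci * RtoC b)%C)
    by (unfold Ci, RtoC, Cplus, Cmult; simpl; f_equal; ring).
  rewrite E at 1. apply Rle_trans with (1 := Cmod_triangle _ _).
  rewrite Cmod_mult, Cmod_Ci, !Cmod_R. unfold Re, Im; simpl. lra.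
Qed.

Lemma im_le_Cmod (z : C) : Rabs (Im z) <= Cmod z.
Proof. eapply Rle_trans; [apply Rmax_r|apply Rmax_Cmod]. Qed.

(** The factor 2 comes from bounding the real and imaginary parts separately. *)
Lemma Cmod_CInt_0oo_le (f : R -> C) (K : R) : Cexp_dominated f ->
  (forall t, 0 <= t -> Cmod (f t) <= K * exp (- t)) -> Cmod (CInt_0oo f) <= 2 * K.
Proof.
  intros [F1 F2] HK. apply Rle_trans with (1 := Cmod_le_Re_Im _).
  assert (Rabs (Re (CInt_0oo f)) <= K).
  { apply (RInt_0oo_le_const _ K); [apply F1|]. intros t Ht.
    apply Rle_trans with (1 := re_le_Cmod _). auto. }
  assert (Rabs (Im (CInt_0oo f)) <= K).
  { apply (RInt_0oo_le_const _ K); [apply F2|]. intros t Ht.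
    apply Rle_trans with (1 := im_le_Cmod _). auto. }
  lra.
Qed.

(** * Laplace transforms in the variable sinh t *)

Definition exp_growth (f : R -> R) : Prop :=
  (forall t, continuous f t) /\
  exists K k, 0 <= K /\ forall t, 0 <= t -> Rabs (f t) <= K * exp (k * t).

Lemma exp_growth_plus (f g : R -> R) :
  exp_growth f -> exp_growth g -> exp_growth (fun t => f t + g t).
Proof.
  intros [Cf [K [k [PK HK]]]] [Cg [L [l [PL HL]]]]. split.
  - intros t. now apply (continuous_plus (V := R_NormedModule) f g).
  - exists (K + L), (Rmax k l). split; [lra|]. intros t Ht.
    apply Rle_trans with (1 := Rabs_triang _ _).
    specialize (HK t Ht). specialize (HL t Ht).
    assert (H : forall p, p <= Rmax k l -> exp (p * t) <= exp (Rmax k l * t)).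
    { intros p Hp. apply (Rmult_le_compat_r t) in Hp; trivial.
      destruct Hp as [Hp| ->]; [left; now apply exp_increasing|lra]. }
    generalize (H k (Rmax_l k l)) (H l (Rmax_r k l)). intros. nra.
Qed.

Lemma exp_growth_mult (f g : R -> R) :
  exp_growth f -> exp_growth g -> exp_growth (fun t => f t * g t).
Proof.
  intros [Cf [K [k [PK HK]]]] [Cg [L [l [PL HL]]]]. split.
  - intros t. now apply (continuous_mult f g).
  - exists (K * L), (k + l). split; [nra|]. intros t Ht.
    rewrite Rabs_mult, Rmult_plus_distr_r, exp_plus.
    replace (K * L * (exp (k * t) * exp (l * t)))
      with (K * exp (k * t) * (L * exp (l * t))) by ring.
    apply Rmult_le_compat; auto using Rabs_pos.
Qed.

Lemma exp_growth_const (c : R) : exp_growth (fun _ => c).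
Proof.
  split; [intros; apply continuous_const|].
  exists (Rabs c), 0. split; [apply Rabs_pos|]. intros. rewrite Rmult_0_l, exp_0. lra.
Qed.

Lemma continuous_of_is_derive (f : R -> R) (l t : R) : is_derive f t l -> continuous f t.
Proof. intros H. apply (@ex_derive_continuous _ R_NormedModule). now exists l. Qed.

Lemma exp_growth_exp (k : R) : exp_growth (fun t => exp (k * t)).
Proof.
  split.
  - intros t. apply continuous_of_is_derive with (k * exp (k * t)). auto_derive; trivial. ring.
  - exists 1, k. split; [lra|]. intros t _. rewrite Rabs_pos_eq by (left; apply exp_pos). lra.
Qed.

Lemma exp_growth_ext (f g : R -> R) :
  (forall t, f t = g t) -> exp_growth f -> exp_growth g.
Proof.
  intros E [Hc [K [k [P HK]]]]. split.
  - intros t. now apply (continuous_ext f).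
  - exists K, k. split; trivial. intros. rewrite <- E. auto.
Qed.

Lemma is_derive_sinh (t : R) : is_derive sinh t (cosh t).
Proof. apply is_derive_Reals, derivable_pt_lim_sinh. Qed.

Lemma is_derive_cosh (t : R) : is_derive cosh t (sinh t).
Proof. apply is_derive_Reals, derivable_pt_lim_cosh. Qed.

Lemma exp_growth_cosh : exp_growth cosh.
Proof.
  apply exp_growth_ext with (fun t => / 2 * (exp (1 * t) + exp (-1 * t))).
  - intros t. unfold cosh. rewrite Rmult_1_l. replace (-1 * t) with (- t) by ring. field.
  - apply exp_growth_mult; [apply exp_growth_const|].
    apply exp_growth_plus; apply exp_growth_exp.
Qed.

Lemma exp_growth_sinh : exp_growth sinh.
Proof.
  apply exp_growth_ext with (fun t => / 2 * (exp (1 * t) + -1 * exp (-1 * t))).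
  - intros t. unfold sinh. rewrite Rmult_1_l. replace (-1 * t) with (- t) by ring. field.
  - apply exp_growth_mult; [apply exp_growth_const|].
    apply exp_growth_plus; [apply exp_growth_exp|].
    apply exp_growth_mult; [apply exp_growth_const|apply exp_growth_exp].
Qed.

(** A quadratic already beats every linear exponent [k t] and allows a comparison by completing the
    square. The derivative estimate is [cosh c >= exp c / 2 >= c / 2]. *)
Lemma sinh_ge_quadratic (t : R) : 0 <= t -> t ^ 2 / 4 <= sinh t.
Proof.
  intros Ht.
  destruct (MVT_gen (fun t => sinh t - t ^ 2 / 4) 0 t (fun t => cosh t - t / 2)) as (c & Hc & E).
  - intros x _. apply (is_derive_minus sinh (fun t => t ^ 2 / 4) x (cosh x) (x / 2)).
    + apply is_derive_sinh.
    + auto_derive; trivial. field.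
  - intros x _. apply continuity_pt_filterlim.
    apply (continuous_of_is_derive (fun t => sinh t - t ^ 2 / 4) (cosh x - x / 2) x).
    apply (is_derive_minus sinh (fun t => t ^ 2 / 4) x (cosh x) (x / 2)).
    + apply is_derive_sinh.
    + auto_derive; trivial. field.
  - rewrite sinh_0 in E.
    assert (c / 2 <= cosh c).
    { assert (0 <= c) by (revert Hc; unfold Rmin; destruct Rle_dec; lra).
      unfold cosh. generalize (exp_pos (- c)) (exp_ineq1_le c). lra. }
    nra.
Qed.

Lemma sinh_ge_0 (t : R) : 0 <= t -> 0 <= sinh t.
Proof. intros Ht. generalize (sinh_ge_quadratic t Ht) (pow2_ge_0 t). lra. Qed.

Lemma exp_le (x y : R) : x <= y -> exp x <= exp y.
Proof. intros [H| ->]; [left; now apply exp_increasing|lra]. Qed.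

(** The constant is uniform in [y >= x], so the resulting bounds on Laplace transforms hold on whole
    half-planes [Re z >= x]. *)
Lemma exp_growth_exp_sinh (f : R -> R) (x : R) : exp_growth f -> 0 < x ->
  exists M, 0 <= M /\ forall y t, x <= y -> 0 <= t ->
    exp (- (y * sinh t)) * Rabs (f t) <= M * exp (- t).
Proof.
  intros [_ (K & k & PK & HK)] Hx.
  (* [(k + 1)^2 / x] is the maximum over [t] of [(k + 1) t - x t^2 / 4]. *)
  exists (K * exp ((k + 1) ^ 2 / x)).
  split; [generalize (exp_pos ((k + 1) ^ 2 / x)); nra|].
  intros y t Hy Ht.
  apply Rle_trans with (exp (- (x * (t ^ 2 / 4))) * (K * exp (k * t))).
  - apply Rmult_le_compat; auto using Rabs_pos.
    + left; apply exp_pos.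
    + apply exp_le. generalize (sinh_ge_quadratic t Ht) (pow2_ge_0 t). nra.
  - replace (exp (- (x * (t ^ 2 / 4))) * (K * exp (k * t)))
      with (K * (exp (- (x * (t ^ 2 / 4))) * exp (k * t))) by ring.
    rewrite <- exp_plus, Rmult_assoc, <- exp_plus.
    apply Rmult_le_compat_l; trivial. apply exp_le.
    assert (0 <= (k + 1) ^ 2 / x - (k + 1) * t + x * (t ^ 2 / 4)).
    { replace ((k + 1) ^ 2 / x - (k + 1) * t + x * (t ^ 2 / 4))
        with (((k + 1) - x * t / 2) ^ 2 / x) by (field; lra).
      apply Rmult_le_pos; [apply pow2_ge_0|left; now apply Rinv_0_lt_compat]. }
    lra.
Qed.

Definition Laplace_sinh (f : R -> R) (z : C) : C :=
  CInt_0oo (fun t => Cexp (- (z * sinh t)) * f t)%C.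

Lemma Re_Cexp_sinh (z : C) (t r : R) :
  Re (Cexp (- (z * sinh t)) * r)%C = exp (- (Re z * sinh t)) * cos (Im z * sinh t) * r.
Proof.
  destruct z as [x y]. unfold Cexp, Cmult, Copp, Re, Im; simpl.
  replace (- (x * 0 + y * sinh t)) with (- (y * sinh t)) by ring.
  rewrite cos_neg. replace (- (x * sinh t - y * 0)) with (- (x * sinh t)) by ring. ring.
Qed.

Lemma Im_Cexp_sinh (z : C) (t r : R) :
  Im (Cexp (- (z * sinh t)) * r)%C = - exp (- (Re z * sinh t)) * sin (Im z * sinh t) * r.
Proof.
  destruct z as [x y]. unfold Cexp, Cmult, Copp, Re, Im; simpl.
  replace (- (x * 0 + y * sinh t)) with (- (y * sinh t)) by ring.
  rewrite sin_neg. replace (- (x * sinh t - y * 0)) with (- (x * sinh t)) by ring. ring.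
Qed.

Lemma Cmod_Cexp_sinh (z : C) (t r : R) :
  Cmod (Cexp (- (z * sinh t)) * r)%C = exp (- (Re z * sinh t)) * Rabs r.
Proof.
  rewrite Cmod_mult, Cmod_R, Cmod_Cexp. do 2 f_equal.
  destruct z as [x y]. unfold Re; simpl. ring.
Qed.

Lemma Cexp_dominated_Laplace_sinh (f : R -> R) (z : C) : exp_growth f -> 0 < Re z ->
  Cexp_dominated (fun t => Cexp (- (z * sinh t)) * f t)%C.
Proof.
  intros Hf Hz. destruct (exp_growth_exp_sinh f (Re z) Hf Hz) as (M & PM & HM).
  assert (B : forall t, 0 <= t -> Cmod (Cexp (- (z * sinh t)) * f t)%C <= M * exp (- t)).
  { intros t Ht. rewrite Cmod_Cexp_sinh. apply HM; trivial. lra. }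
  assert (Cs : forall y t, continuous (fun t => y * sinh t) t).
  { intros y t. apply (continuous_scal_r (V := R_NormedModule) y).
    apply continuous_of_is_derive with (cosh t), is_derive_sinh. }
  assert (Ce : forall t, continuous (fun t => exp (- (Re z * sinh t))) t).
  { intros t. apply (continuous_comp (fun t => Re z * sinh t) (fun s => exp (- s))); [apply Cs|].
    eapply continuous_of_is_derive. auto_derive; trivial. }
  split; split.
  - intros t. eapply continuous_ext; [intros; symmetry; apply Re_Cexp_sinh|].
    apply (continuous_mult (fun t => exp (- (Re z * sinh t)) * cos (Im z * sinh t)) f); [|apply Hf].
    apply (continuous_mult (fun t => exp (- (Re z * sinh t))) (fun t => cos (Im z * sinh t))); [apply Ce|].
    apply (continuous_comp (fun t => Im z * sinh t) cos); [apply Cs|].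
    eapply continuous_of_is_derive. auto_derive; trivial.
  - exists M. intros t Ht. apply Rle_trans with (1 := re_le_Cmod _). auto.
  - intros t. eapply continuous_ext; [intros; symmetry; apply Im_Cexp_sinh|].
    apply (continuous_mult (fun t => - exp (- (Re z * sinh t)) * sin (Im z * sinh t)) f); [|apply Hf].
    apply (continuous_mult (fun t => - exp (- (Re z * sinh t))) (fun t => sin (Im z * sinh t))).
    { apply (continuous_opp (V := R_NormedModule)), Ce. }
    apply (continuous_comp (fun t => Im z * sinh t) sin); [apply Cs|].
    eapply continuous_of_is_derive. auto_derive; trivial.
  - exists M. intros t Ht. apply Rle_trans with (1 := im_le_Cmod _). auto.
Qed.

Lemma Laplace_sinh_bounded (f : R -> R) (x : R) : exp_growth f -> 0 < x ->
  exists M, 0 <= M /\ forall z, x <= Re z -> Cmod (Laplace_sinh f z) <= M.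
Proof.
  intros Hf Hx. destruct (exp_growth_exp_sinh f x Hf Hx) as (M & PM & HM).
  exists (2 * M). split; [lra|]. intros z Hz.
  apply Cmod_CInt_0oo_le.
  - apply Cexp_dominated_Laplace_sinh; trivial. lra.
  - intros t Ht. rewrite Cmod_Cexp_sinh. auto.
Qed.

Lemma Laplace_sinh_ext (f g : R -> R) (z : C) :
  (forall t, f t = g t) -> Laplace_sinh f z = Laplace_sinh g z.
Proof. intros H. apply CInt_0oo_ext. intros t. now rewrite H. Qed.

Lemma Laplace_sinh_plus (f g : R -> R) (z : C) : exp_growth f -> exp_growth g -> 0 < Re z ->
  Laplace_sinh (fun t => f t + g t) z = (Laplace_sinh f z + Laplace_sinh g z)%C.
Proof.
  intros Hf Hg Hz. unfold Laplace_sinh.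
  rewrite <- CInt_0oo_plus by now apply Cexp_dominated_Laplace_sinh.
  apply CInt_0oo_ext. intros t. rewrite RtoC_plus. ring.
Qed.

Lemma Laplace_sinh_scal (c : R) (f : R -> R) (z : C) : exp_growth f -> 0 < Re z ->
  Laplace_sinh (fun t => c * f t) z = (c * Laplace_sinh f z)%C.
Proof.
  intros Hf Hz. unfold Laplace_sinh.
  rewrite <- CInt_0oo_scal by now apply Cexp_dominated_Laplace_sinh.
  apply CInt_0oo_ext. intros t. rewrite RtoC_mult. ring.
Qed.

(** The Taylor error of the kernel is integrated directly: it equals
    [exp (- z sinh t) (exp k - 1 - k)] with [k = - (w - z) sinh t]. For [|w - z| < Re z / 2] the
    factor [exp |k|] costs at most half of the decay, and the other half still dominates
    [sinh^2 t f t]. *)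
Lemma is_Cderive_Laplace_sinh (f : R -> R) (z : C) : exp_growth f -> 0 < Re z ->
  is_Cderive (Laplace_sinh f) z (- Laplace_sinh (fun t => sinh t * f t)%R z)%C.
Proof.
  intros Hf Hz.
  assert (Hs : exp_growth (fun t => sinh t * f t))
    by (apply exp_growth_mult; [apply exp_growth_sinh|trivial]).
  destruct (exp_growth_exp_sinh (fun t => sinh t * (sinh t * f t)) (Re z / 2)) as (M & PM & HM);
    [apply exp_growth_mult; [apply exp_growth_sinh|trivial]|lra|].
  apply is_Cderive_quadratic with (Re z / 2) (2 * (3 * M)); [lra|].
  intros w Hw.
  assert (Hw0 : 0 < Re w).
  { generalize (re_le_Cmod (w - z)). intros H.
    destruct z as [x y], w as [u v]. unfold Re in *; simpl in *.
    assert (K : Rabs (u + - x) < x / 2) by lra. apply Rabs_def2 in K. lra. }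
  set (d := (w - z)%C) in *.
  unfold Laplace_sinh.
  replace (_ - _ - _)%C with
    (CInt_0oo (fun t => Cexp (- (w * sinh t)) * f t) +
     ((-1) * CInt_0oo (fun t => Cexp (- (z * sinh t)) * f t) +
      d * CInt_0oo (fun t => Cexp (- (z * sinh t)) * (RtoC (sinh t * f t)%R))))%C by ring.
  assert (D1 := Cexp_dominated_Laplace_sinh f w Hf Hw0).
  assert (D2 := Cexp_dominated_Laplace_sinh f z Hf Hz).
  assert (D3 := Cexp_dominated_Laplace_sinh _ z Hs Hz). cbv beta in D3.
  assert (D2' := Cexp_dominated_scal (-1) _ D2).
  assert (D3' := Cexp_dominated_scal d _ D3).
  assert (D4 := Cexp_dominated_plus _ _ D2' D3').
  rewrite <- !CInt_0oo_scal, <- !CInt_0oo_plus by trivial.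
  rewrite Rmult_assoc.
  replace (2 * (3 * M * Cmod d ^ 2)) with (2 * ((3 * M * Cmod d ^ 2))) by ring.
  apply Cmod_CInt_0oo_le; [now apply Cexp_dominated_plus|].
  intros t Ht.
  set (k := (- (d * sinh t))%C).
  replace (Cexp (- (w * sinh t))) with (Cexp (- (z * sinh t)) * Cexp k)%C
    by (rewrite <- Cexp_plus; f_equal; unfold k, d; ring).
  replace (_ + _)%C with ((Cexp k - 1 - k) * (Cexp (- (z * sinh t)) * f t))%C
    by (unfold k; rewrite RtoC_mult; ring).
  rewrite Cmod_mult, Cmod_Cexp_sinh.
  assert (Ps := sinh_ge_0 t Ht).
  assert (Ek : Cmod k = Cmod d * sinh t).
  { unfold k. rewrite Cmod_opp, Cmod_mult, Cmod_R, Rabs_pos_eq; trivial. }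
  assert (L : Cmod (Cexp k - 1 - k) <= 3 * (Cmod d ^ 2 * (sinh t * sinh t)) * exp (Re z / 2 * sinh t)).
  { apply Rle_trans with (1 := Cmod_Cexp_taylor1 k). rewrite Ek.
    replace ((Cmod d * sinh t) ^ 2) with (Cmod d ^ 2 * (sinh t * sinh t)) by ring.
    apply Rmult_le_compat_l.
    - generalize (pow2_ge_0 (Cmod d)). nra.
    - apply exp_le. apply Rmult_le_compat_r; lra. }
  apply Rle_trans with
    (3 * (Cmod d ^ 2 * (sinh t * sinh t)) * exp (Re z / 2 * sinh t) * (exp (- (Re z * sinh t)) * Rabs (f t))).
  { apply Rmult_le_compat_r; trivial.
    apply Rmult_le_pos; [left; apply exp_pos|apply Rabs_pos]. }
  replace (_ * (_ * _)) with
    (3 * Cmod d ^ 2 * ((exp (Re z / 2 * sinh t) * exp (- (Re z * sinh t))) * (sinh t * (sinh t * Rabs (f t))))) by ring.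
  rewrite <- exp_plus.
  replace (Re z / 2 * sinh t + - (Re z * sinh t)) with (- (Re z / 2 * sinh t)) by field.
  replace (3 * M * Cmod d ^ 2 * exp (- t)) with (3 * Cmod d ^ 2 * (M * exp (- t))) by ring.
  apply Rmult_le_compat_l; [generalize (pow2_ge_0 (Cmod d)); lra|].
  specialize (HM (Re z / 2) t (Rle_refl _) Ht).
  rewrite !Rabs_mult, (Rabs_pos_eq (sinh t)) in HM by trivial. exact HM.
Qed.

(** The kernel has [t]-derivative [- z cosh t exp (- z sinh t)]. So
    [exp (- z sinh t) (g' t - z cosh t g t)] is the derivative of the kernel times [g], which
    vanishes at infinity and equals [g 0] at 0. *)
Lemma Laplace_sinh_parts (g g' : R -> R) (z : C) : (forall t, is_derive g t (g' t)) ->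
  exp_growth g -> exp_growth g' -> 0 < Re z ->
  (z * Laplace_sinh (fun t => cosh t * g t)%R z = g 0 + Laplace_sinh g' z)%C.
Proof.
  intros Hd Hg Hg' Hz.
  assert (Hc : exp_growth (fun t => cosh t * g t))
    by (apply exp_growth_mult; [apply exp_growth_cosh|trivial]).
  assert (D1 := Cexp_dominated_Laplace_sinh g' z Hg' Hz).
  assert (D2 := Cexp_dominated_Laplace_sinh _ z Hc Hz). cbv beta in D2.
  destruct (exp_growth_exp_sinh g (Re z) Hg Hz) as (M & PM & HM).
  assert (B : forall t, 0 <= t -> Cmod (Cexp (- (z * sinh t)) * g t)%C <= M * exp (- t)).
  { intros t Ht. rewrite Cmod_Cexp_sinh. apply HM; trivial. lra. }
  assert (D3 := Cexp_dominated_plus _ _ D1 (Cexp_dominated_scal (- z) _ D2)).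
  enough (E : CInt_0oo (fun t => Cexp (- (z * sinh t)) * g' t
              + - z * (Cexp (- (z * sinh t)) * RtoC (cosh t * g t)%R))%C = (- g 0)%C).
  { rewrite CInt_0oo_plus, CInt_0oo_scal in E by (trivial; now apply Cexp_dominated_scal).
    unfold Laplace_sinh.
    transitivity (- (- z * CInt_0oo (fun t => Cexp (- (z * sinh t)) * RtoC (cosh t * g t)%R)))%C; [ring|].
    replace (RtoC (g 0)) with (- - g 0)%C by ring. rewrite <- E. ring. }
  assert (Hsc : forall x t, is_derive (fun t => x * sinh t) t (x * cosh t))
    by (intros; apply (is_derive_scal sinh t x (cosh t)), is_derive_sinh).
  destruct D3 as [[C1 _] [C2 _]].
  replace (- g 0)%C with ((- g 0)%R, 0) by (unfold RtoC, Copp; simpl; f_equal; ring).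
  unfold CInt_0oo. f_equal.
  - rewrite (RInt_0oo_derive (fun t => Re (Cexp (- (z * sinh t)) * g t)%C)).
    + rewrite Re_Cexp_sinh, sinh_0, !Rmult_0_r, Ropp_0, exp_0, cos_0. ring.
    + intros t. eapply is_derive_ext; [intros; symmetry; apply Re_Cexp_sinh|].
      evar_last.
      * apply (is_derive_mult (fun t => exp (- (Re z * sinh t)) * cos (Im z * sinh t)) g);
          [|apply Hd|apply Rmult_comm].
        apply (is_derive_mult (fun t => exp (- (Re z * sinh t))) (fun t => cos (Im z * sinh t)));
          [| |apply Rmult_comm].
        -- apply (is_derive_comp (fun s => exp (- s)) (fun t => Re z * sinh t)); [|apply Hsc].
           auto_derive; trivial.
        -- apply (is_derive_comp cos (fun t => Im z * sinh t)); [|apply Hsc].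
           auto_derive; trivial.
      * destruct z as [x y]. rewrite re_plus, Re_Cexp_sinh.
        unfold Cexp, Cmult, Copp, Re, Im, plus, mult, scal; simpl. unfold mult; simpl.
        replace (- (x * 0 + y * sinh t)) with (- (y * sinh t)) by ring.
        replace (- (x * sinh t - y * 0)) with (- (x * sinh t)) by ring.
        rewrite cos_neg, sin_neg. ring.
    + exact C1.
    + exists M. intros t Ht. apply Rle_trans with (1 := re_le_Cmod _). auto.
  - rewrite (RInt_0oo_derive (fun t => Im (Cexp (- (z * sinh t)) * g t)%C)).
    + rewrite Im_Cexp_sinh, sinh_0, !Rmult_0_r, sin_0. ring.
    + intros t. eapply is_derive_ext; [intros; symmetry; apply Im_Cexp_sinh|].
      evar_last.
      * apply (is_derive_mult (fun t => - exp (- (Re z * sinh t)) * sin (Im z * sinh t)) g);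
          [|apply Hd|apply Rmult_comm].
        apply (is_derive_mult (fun t => - exp (- (Re z * sinh t))) (fun t => sin (Im z * sinh t)));
          [| |apply Rmult_comm].
        -- apply (is_derive_comp (fun s => - exp (- s)) (fun t => Re z * sinh t)); [|apply Hsc].
           auto_derive; trivial.
        -- apply (is_derive_comp sin (fun t => Im z * sinh t)); [|apply Hsc].
           auto_derive; trivial.
      * destruct z as [x y]. rewrite im_plus, Im_Cexp_sinh.
        unfold Cexp, Cmult, Copp, Re, Im, plus, mult, scal; simpl. unfold mult; simpl.
        replace (- (x * 0 + y * sinh t)) with (- (y * sinh t)) by ring.
        replace (- (x * sinh t - y * 0)) with (- (x * sinh t)) by ring.
        rewrite cos_neg, sin_neg. ring.
    + exact C2.
    + exists M. intros t Ht. apply Rle_trans with (1 := im_le_Cmod _). auto.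
Qed.

(** * The integral solution of the Lommel equation *)

(* [s ^ b] extended by [0] to [s <= 0], where [Rpower] is junk; continuous for [0 < b]. *)
Definition pos_power (b s : R) : R := if Rle_dec s 0 then 0 else Rpower s b.

Lemma pos_power_0 (b s : R) : s <= 0 -> pos_power b s = 0.
Proof. intros H. unfold pos_power. destruct Rle_dec; lra. Qed.

Lemma pos_power_Rpower (b s : R) : 0 < s -> pos_power b s = Rpower s b.
Proof. intros H. unfold pos_power. destruct Rle_dec; lra. Qed.

Lemma pos_power_gt_0 (b s : R) : 0 < s -> 0 < pos_power b s.
Proof. intros H. rewrite pos_power_Rpower by trivial. apply exp_pos. Qed.

Lemma pos_power_ge_0 (b s : R) : 0 <= pos_power b s.
Proof. unfold pos_power. destruct Rle_dec; [lra|left; apply exp_pos]. Qed.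

Lemma pos_power_succ (b s : R) : s * pos_power b s = pos_power (b + 1) s.
Proof.
  unfold pos_power. destruct Rle_dec; [ring|].
  rewrite Rpower_plus, Rpower_1 by lra. ring.
Qed.

Lemma is_derive_Rpower (b s : R) : 0 < s ->
  is_derive (fun s => Rpower s b) s (b * Rpower s (b - 1)).
Proof. intros H. apply is_derive_Reals, derivable_pt_lim_power, H. Qed.

Lemma is_derive_pos_power (b s : R) : 0 < s ->
  is_derive (pos_power b) s (b * pos_power (b - 1) s).
Proof.
  intros H. rewrite pos_power_Rpower by trivial.
  apply is_derive_ext_loc with (2 := is_derive_Rpower b s H).
  exists (mkposreal s H). intros t Ht. change (Rabs (t - s) < s) in Ht. apply Rabs_def2 in Ht.
  symmetry. apply pos_power_Rpower. lra.
Qed.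

Lemma pos_power_small (b eps : R) : 0 < b -> 0 < eps ->
  exists d, 0 < d /\ forall t, Rabs t < d -> pos_power b t < eps.
Proof.
  intros Hb He. exists (Rpower eps (/ b)). split; [apply exp_pos|].
  intros t Ht. destruct (Rle_dec t 0) as [H|H]; [now rewrite pos_power_0|].
  rewrite pos_power_Rpower by lra. rewrite Rabs_pos_eq in Ht by lra.
  replace eps with (Rpower (Rpower eps (/ b)) b).
  - unfold Rpower at 1 2. apply exp_increasing, Rmult_lt_compat_l; trivial.
    apply ln_increasing; lra.
  - rewrite Rpower_mult, Rinv_l, Rpower_1; lra.
Qed.

Lemma pos_power_locally_0 (b s : R) : s < 0 -> locally s (fun t => 0 = pos_power b t).
Proof.
  intros H. assert (H' : 0 < - s) by lra.
  exists (mkposreal _ H'). intros t Ht. change (Rabs (t - s) < - s) in Ht. apply Rabs_def2 in Ht.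
  symmetry. apply pos_power_0. lra.
Qed.

Lemma continuous_pos_power (b s : R) : 0 < b -> continuous (pos_power b) s.
Proof.
  intros Hb. destruct (Rtotal_order s 0) as [H|[->|H]].
  - apply continuous_ext_loc with (fun _ => 0); [now apply pos_power_locally_0|apply continuous_const].
  - apply filterlim_locally. intros eps.
    destruct (pos_power_small b eps Hb (cond_pos eps)) as (d & Hd & K).
    exists (mkposreal d Hd). intros t Ht. change (Rabs (t - 0) < d) in Ht. rewrite Rminus_0_r in Ht.
    change (Rabs (pos_power b t - pos_power b 0) < eps).
    rewrite (pos_power_0 b 0), Rminus_0_r, Rabs_pos_eq by (lra || apply pos_power_ge_0). auto.
  - eapply continuous_of_is_derive. now apply is_derive_pos_power.
Qed.

(** At 0 the difference quotient is [pos_power b t], which tends to 0. *)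
Lemma is_derive_pos_power_succ (b s : R) : 0 < b ->
  is_derive (pos_power (b + 1)) s ((b + 1) * pos_power b s).
Proof.
  intros Hb. destruct (Rtotal_order s 0) as [H|[->|H]].
  - rewrite pos_power_0, Rmult_0_r by lra.
    apply is_derive_ext_loc with (fun _ => 0); [now apply pos_power_locally_0|].
    apply (is_derive_const (V := R_NormedModule)).
  - rewrite pos_power_0, Rmult_0_r by lra. split; [apply is_linear_scal_l|].
    intros x Hx. rewrite <- (is_filter_lim_locally_unique _ _ Hx). intros eps.
    destruct (pos_power_small b eps Hb (cond_pos eps)) as (d & Hd & K).
    exists (mkposreal d Hd). intros t Ht. change (Rabs (t - 0) < d) in Ht. rewrite Rminus_0_r in Ht.
    change (Rabs (pos_power (b + 1) t - pos_power (b + 1) 0 - (t - 0) * 0) <= eps * Rabs (t - 0)).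
    rewrite (pos_power_0 _ 0), <- pos_power_succ by lra.
    replace (t * pos_power b t - 0 - (t - 0) * 0) with (pos_power b t * t) by ring.
    rewrite Rminus_0_r, Rabs_mult. apply Rmult_le_compat_r; [apply Rabs_pos|].
    rewrite Rabs_pos_eq by apply pos_power_ge_0. left; auto.
  - assert (D := is_derive_pos_power (b + 1) s H).
    replace (b + 1 - 1) with b in D by ring. exact D.
Qed.

Lemma continuous_pos_power_sinh (b t : R) : 0 < b ->
  continuous (fun t => pos_power b (sinh t)) t.
Proof.
  intros Hb. apply (continuous_comp sinh (pos_power b)).
  - apply continuous_of_is_derive with (cosh t), is_derive_sinh.
  - now apply continuous_pos_power.
Qed.

Lemma exp_growth_pos_power_sinh (b : R) : 0 < b -> exp_growth (fun t => pos_power b (sinh t)).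
Proof.
  intros Hb. split; [intros; now apply continuous_pos_power_sinh|].
  exists 1, b. split; [lra|]. intros t Ht. rewrite Rmult_1_l, Rabs_pos_eq by apply pos_power_ge_0.
  destruct (Rle_dec (sinh t) 0) as [H|H].
  - rewrite pos_power_0 by trivial. left; apply exp_pos.
  - rewrite pos_power_Rpower by lra. unfold Rpower. apply exp_le, Rmult_le_compat_l; [lra|].
    rewrite <- (ln_exp t) at 2. apply ln_le; [lra|].
    unfold sinh. generalize (exp_pos t) (exp_pos (- t)). lra.
Qed.

(** * Convolutions of hyperbolic functions with powers of [sinh] *)

Lemma is_derive_RInt_0 (f : R -> R) (t : R) : (forall t, continuous f t) ->
  is_derive (fun t => RInt f 0 t) t (f t).
Proof.
  intros Hf. apply (is_derive_RInt f (fun t => RInt f 0 t) 0); [|apply Hf].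
  apply filter_forall. intros x. now apply (@RInt_correct R_CompleteNormedModule), ex_RInt_all.
Qed.

Lemma exp_growth_RInt (f : R -> R) : exp_growth f -> exp_growth (fun t => RInt f 0 t).
Proof.
  intros [Hc (K & k & PK & HK)]. split.
  - intros t. eapply continuous_of_is_derive. now apply is_derive_RInt_0.
  - exists K, (Rabs k + 1). split; trivial. intros t Ht.
    apply Rle_trans with ((t - 0) * (K * exp (Rabs k * t))).
    + apply abs_RInt_le_const; trivial; [now apply ex_RInt_all|].
      intros s Hs. apply Rle_trans with (1 := HK s (proj1 Hs)).
      apply Rmult_le_compat_l; trivial. apply exp_le.
      generalize (Rle_abs k) (Rabs_pos k). nra.
    + rewrite Rmult_plus_distr_r, Rmult_1_l, exp_plus.
      generalize (exp_ineq1_le t) (exp_pos (Rabs k * t)). intros.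
      replace ((t - 0) * (K * exp (Rabs k * t))) with (K * exp (Rabs k * t) * t) by ring.
      rewrite <- Rmult_assoc. apply Rmult_le_compat_l; nra.
Qed.

(** The convolution of [exp (nu t)] with [sinh^b], with the factor [exp (nu t)] pulled out of the
    integral: the integrand is then free of [t] and the product rule suffices. *)
Definition exp_conv (b nu t : R) : R :=
  exp (nu * t) * RInt (fun r => exp (- nu * r) * pos_power b (sinh r)) 0 t.

Lemma continuous_exp_conv_integrand (b nu r : R) : 0 < b ->
  continuous (fun r => exp (- nu * r) * pos_power b (sinh r)) r.
Proof.
  intros Hb. apply (continuous_mult (fun r => exp (- nu * r))).
  - apply exp_growth_exp.
  - now apply continuous_pos_power_sinh.
Qed.

Lemma is_derive_exp_conv (b nu t : R) : 0 < b ->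
  is_derive (exp_conv b nu) t (nu * exp_conv b nu t + pos_power b (sinh t)).
Proof.
  intros Hb. unfold exp_conv. evar_last.
  - apply (is_derive_mult (fun t => exp (nu * t))); [|apply is_derive_RInt_0|apply Rmult_comm].
    + auto_derive; trivial.
    + intros; now apply continuous_exp_conv_integrand.
  - unfold plus, mult; simpl.
    assert (E : exp (nu * t) * exp (- nu * t) = 1).
    { rewrite <- exp_plus, <- exp_0. f_equal. ring. }
    replace (exp (nu * t) * (exp (- nu * t) * pos_power b (sinh t)))
      with (exp (nu * t) * exp (- nu * t) * pos_power b (sinh t)) by ring.
    rewrite E. ring.
Qed.

Lemma exp_growth_exp_conv (b nu : R) : 0 < b -> exp_growth (exp_conv b nu).
Proof.
  intros Hb. apply exp_growth_mult; [apply exp_growth_exp|].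
  apply exp_growth_RInt, exp_growth_mult; [apply exp_growth_exp|].
  now apply exp_growth_pos_power_sinh.
Qed.

Lemma exp_conv_0 (b nu : R) : exp_conv b nu 0 = 0.
Proof. unfold exp_conv. rewrite RInt_point. apply Rmult_0_r. Qed.

(* The convolutions of [sinh^b] with [cosh (nu t)] and [sinh (nu t)]. *)
Definition cosh_conv (b nu t : R) : R := / 2 * (exp_conv b nu t + exp_conv b (- nu) t).
Definition sinh_conv (b nu t : R) : R := / 2 * (exp_conv b nu t + -1 * exp_conv b (- nu) t).

(** Together with the derivative of [sinh_conv], this is a first-order form of
    [I'' - nu^2 I = (sinh^b)']. It never differentiates [sinh^b], whose derivative blows up at 0
    when [b < 1]. *)
Lemma is_derive_cosh_conv (b nu t : R) : 0 < b ->
  is_derive (cosh_conv b nu) t (nu * sinh_conv b nu t + pos_power b (sinh t)).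
Proof.
  intros Hb. unfold cosh_conv, sinh_conv. evar_last.
  - apply is_derive_scal. apply @is_derive_plus; now apply is_derive_exp_conv.
  - unfold plus; simpl. field.
Qed.

Lemma is_derive_sinh_conv (b nu t : R) : 0 < b ->
  is_derive (sinh_conv b nu) t (nu * cosh_conv b nu t).
Proof.
  intros Hb. unfold cosh_conv, sinh_conv. evar_last.
  - apply is_derive_scal. apply @is_derive_plus; [|apply is_derive_scal]; now apply is_derive_exp_conv.
  - unfold plus; simpl. field.
Qed.

Lemma exp_growth_cosh_conv (b nu : R) : 0 < b -> exp_growth (cosh_conv b nu).
Proof.
  intros Hb. apply exp_growth_mult; [apply exp_growth_const|].
  apply exp_growth_plus; now apply exp_growth_exp_conv.
Qed.

Lemma exp_growth_sinh_conv (b nu : R) : 0 < b -> exp_growth (sinh_conv b nu).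
Proof.
  intros Hb. apply exp_growth_mult; [apply exp_growth_const|].
  apply exp_growth_plus; [|apply exp_growth_mult; [apply exp_growth_const|]]; now apply exp_growth_exp_conv.
Qed.

(** * The Laplace transform of a power *)

(* The substitution [p = sinh t] turns this into the integral of
   [exp (- z p) p ^ b], that is [Gamma (b + 1) / z ^ (b + 1)]. *)
Definition Gamma_Laplace (b : R) (z : C) : C :=
  Laplace_sinh (fun t => cosh t * pos_power b (sinh t)) z.

Lemma exp_growth_cosh_pos_power (b : R) : 0 < b ->
  exp_growth (fun t => cosh t * pos_power b (sinh t)).
Proof.
  intros Hb. apply exp_growth_mult; [apply exp_growth_cosh|now apply exp_growth_pos_power_sinh].
Qed.

(** The functional equation of Gamma, by parts: the boundary value of [pos_power (b + 1) (sinh t)]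
    at 0 is 0. *)
Lemma Gamma_Laplace_succ (b : R) (z : C) : 0 < b -> 0 < Re z ->
  (z * Gamma_Laplace (b + 1) z = (b + 1)%R * Gamma_Laplace b z)%C.
Proof.
  intros Hb Hz. unfold Gamma_Laplace.
  rewrite (Laplace_sinh_parts (fun t => pos_power (b + 1) (sinh t))
     (fun t => (b + 1) * (cosh t * pos_power b (sinh t)))); trivial.
  - rewrite sinh_0, pos_power_0 by lra.
    rewrite Laplace_sinh_scal by (trivial; now apply exp_growth_cosh_pos_power). ring.
  - intros t. evar_last.
    + apply (is_derive_comp (pos_power (b + 1)) sinh).
      * now apply is_derive_pos_power_succ.
      * apply is_derive_sinh.
    + unfold scal; simpl; unfold mult; simpl. ring.
  - apply exp_growth_pos_power_sinh. lra.
  - apply exp_growth_mult; [apply exp_growth_const|now apply exp_growth_cosh_pos_power].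
Qed.

(** Differentiation multiplies the weight by [sinh t], that is, raises [b] by one; the functional
    equation brings it back. The outcome is the first-order equation of [z^(- b - 1)]. *)
Lemma is_Cderive_Gamma_Laplace (b : R) (z : C) : 0 < b -> 0 < Re z ->
  is_Cderive (Gamma_Laplace b) z (- ((b + 1)%R / z) * Gamma_Laplace b z)%C.
Proof.
  intros Hb Hz. assert (Hz0 := Re_pos_neq_0 z Hz).
  replace (- ((b + 1)%R / z) * Gamma_Laplace b z)%C with (- Gamma_Laplace (b + 1) z)%C.
  - unfold Gamma_Laplace. rewrite (Laplace_sinh_ext _ (fun t => sinh t * (cosh t * pos_power b (sinh t)))).
    + apply is_Cderive_Laplace_sinh; trivial. now apply exp_growth_cosh_pos_power.
    + intros t. rewrite <- pos_power_succ. ring.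
  - replace (Gamma_Laplace (b + 1) z) with (/ z * (z * Gamma_Laplace (b + 1) z))%C by (field; trivial).
    rewrite Gamma_Laplace_succ by trivial. field. trivial.
Qed.

Lemma Cderive_0_const (F : C -> C) : (forall z, 0 < Re z -> is_Cderive F z 0) ->
  forall z, 0 < Re z -> F z = F 1.
Proof.
  intros H z Hz.
  (* The segment from 1 to [z] stays in the half-plane by convexity. *)
  assert (K : forall t : R, 0 <= t <= 1 -> is_Cderive F (1 + t * (z - 1))%C 0).
  { intros t Ht. apply H. destruct z as [x y]. unfold Re in *; simpl in *. nra. }
  assert (E0 : (1 + 0%R * (z - 1))%C = 1) by ring.
  assert (E1 : (1 + 1%R * (z - 1))%C = z) by ring.
  assert (Z : ((z - 1) * 0 = 0)%C) by ring.
  apply injective_projections.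
  - assert (A : forall t : R, 0 <= t <= 1 ->
      is_derive (fun t : R => Re (F (1 + t * (z - 1))%C)) t zero).
    { intros t Ht. destruct (is_Cderive_along_Re F 1 (z - 1) 0 t (K t Ht)) as [D _].
      rewrite Z in D. exact D. }
    apply (eq_is_derive _ 0 1) in A; [|lra]. cbv beta in A. rewrite E0, E1 in A. symmetry. exact A.
  - assert (A : forall t : R, 0 <= t <= 1 ->
      is_derive (fun t : R => Im (F (1 + t * (z - 1))%C)) t zero).
    { intros t Ht. destruct (is_Cderive_along_Re F 1 (z - 1) 0 t (K t Ht)) as [_ D].
      rewrite Z in D. exact D. }
    apply (eq_is_derive _ 0 1) in A; [|lra]. cbv beta in A. rewrite E0, E1 in A. symmetry. exact A.
Qed.

(** The product of [z^(b + 1)] and the transform has derivative 0. The constant [Gamma_Laplace b 1]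
    is [Gamma (b + 1)]; only its being nonzero is used later. *)
Lemma Gamma_Laplace_Cppow (b : R) (z : C) : 0 < b -> 0 < Re z ->
  Gamma_Laplace b z = (Gamma_Laplace b 1 * Cppow z (- b - 1))%C.
Proof.
  intros Hb Hz.
  assert (E : (Cppow z (b + 1) * Gamma_Laplace b z)%C = (Cppow 1 (b + 1) * Gamma_Laplace b 1)%C).
  { apply (Cderive_0_const (fun z => Cppow z (b + 1) * Gamma_Laplace b z)%C); trivial.
    intros w Hw.
    replace (RtoC 0) with ((b + 1) / w * Cppow w (b + 1) * Gamma_Laplace b w +
      Cppow w (b + 1) * (- ((b + 1)%R / w) * Gamma_Laplace b w))%C
      by (rewrite RtoC_plus; unfold Cdiv; ring).
    apply (is_Cderive_mult (fun w => Cppow w (b + 1)) (Gamma_Laplace b));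
      [now apply is_Cderive_Cppow|now apply is_Cderive_Gamma_Laplace]. }
  assert (E1 : Cppow 1 (b + 1) = 1).
  { rewrite <- RtoC_plus, Cppow_RtoC by lra. unfold Rpower. now rewrite ln_1, Rmult_0_r, exp_0. }
  assert (E2 : (Cppow z (b + 1) * Cppow z (- b - 1) = 1)%C).
  { rewrite <- Cppow_plus. replace (b + 1 + (- b - 1))%C with (RtoC 0) by ring.
    unfold Cppow. rewrite Cmult_0_l. apply Cexp_0. }
  rewrite E1, Cmult_1_l in E. rewrite <- E.
  transitivity (Cppow z (b + 1) * Cppow z (- b - 1) * Gamma_Laplace b z)%C; [rewrite E2|]; ring.
Qed.

Lemma Laplace_sinh_RtoC (f : R -> R) (x : R) :
  Laplace_sinh f x = RtoC (RInt_0oo (fun t => exp (- (x * sinh t)) * f t)).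
Proof.
  apply (f_equal2 (@pair R R)).
  - apply RInt_0oo_ext. intros t. rewrite Re_Cexp_sinh. simpl. rewrite Rmult_0_l, cos_0. ring.
  - rewrite (RInt_0oo_ext _ (fun _ => 0)).
    + apply RInt_0oo_unique. apply is_lim_seq_ext with (fun _ => 0); [|apply is_lim_seq_const].
      intros n. symmetry. rewrite RInt_const. apply Rmult_0_r.
    + intros t. rewrite Im_Cexp_sinh. simpl. rewrite Rmult_0_l, sin_0. ring.
Qed.

Lemma exp_dominated_exp_sinh (f : R -> R) (x : R) : exp_growth f -> 0 < x ->
  exp_dominated (fun t => exp (- (x * sinh t)) * f t).
Proof.
  intros Hf Hx.
  destruct (Cexp_dominated_Laplace_sinh f x Hf Hx) as [H _].
  apply exp_dominated_ext with (2 := H).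
  intros t. rewrite Re_Cexp_sinh. simpl. rewrite Rmult_0_l, cos_0. ring.
Qed.

Lemma RInt_0oo_exp_sinh_gt_0 (f : R -> R) (x : R) : exp_growth f -> 0 < x ->
  (forall t, 0 < t -> 0 < f t) -> 0 < RInt_0oo (fun t => exp (- (x * sinh t)) * f t).
Proof.
  intros Hf Hx Hp. apply RInt_0oo_gt_0; [now apply exp_dominated_exp_sinh|].
  intros t Ht. apply Rmult_lt_0_compat; [apply exp_pos|auto].
Qed.

(** Write [H], [H1], [H2] for the transforms of [I], [sinh I], [sinh^2 I], [T] for that of
    [nu cosh sinh_conv], and [G] for [Gamma_Laplace b z]. Integration by parts gives [z T = nu^2 H]
    and, since [cosh^2 = 1 + sinh^2], also [z (H + H2) = H1 + T + G]. Eliminating [T] leaves the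
    equation. *)
Lemma Laplace_cosh_conv_ode (b nu : R) (z : C) : 0 < b -> 0 < Re z ->
  (Laplace_sinh (fun t => sinh t * (sinh t * cosh_conv b nu t))%R z
   + 1 / z * - Laplace_sinh (fun t => sinh t * cosh_conv b nu t)%R z
   + (1 - nu ^ 2 / z ^ 2) * Laplace_sinh (cosh_conv b nu) z
   = Gamma_Laplace b z / z)%C.
Proof.
  intros Hb Hz. assert (Hz0 := Re_pos_neq_0 z Hz).
  assert (Gi := exp_growth_cosh_conv b nu Hb).
  assert (Gs := exp_growth_sinh_conv b nu Hb).
  assert (Gp := exp_growth_cosh_pos_power b Hb).
  assert (Gcs : exp_growth (fun t => cosh t * (nu * sinh_conv b nu t))).
  { apply exp_growth_mult; [apply exp_growth_cosh|].
    apply exp_growth_mult; [apply exp_growth_const|trivial]. }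
  assert (Gsi : exp_growth (fun t => sinh t * cosh_conv b nu t))
    by (apply exp_growth_mult; [apply exp_growth_sinh|trivial]).
  assert (Gssi : exp_growth (fun t => sinh t * (sinh t * cosh_conv b nu t)))
    by (apply exp_growth_mult; [apply exp_growth_sinh|trivial]).
  assert (D1 : forall t, is_derive (fun t => nu * sinh_conv b nu t) t (nu * nu * cosh_conv b nu t)).
  { intros t. rewrite Rmult_assoc. apply is_derive_scal. now apply is_derive_sinh_conv. }
  assert (D2 : forall t, is_derive (fun t => cosh t * cosh_conv b nu t) t
     (sinh t * cosh_conv b nu t + (cosh t * (nu * sinh_conv b nu t) + cosh t * pos_power b (sinh t)))).
  { intros t. evar_last.
    - apply (is_derive_mult cosh (cosh_conv b nu));
        [apply is_derive_cosh|now apply is_derive_cosh_conv|apply Rmult_comm].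
    - unfold plus, mult; simpl. ring. }
  assert (P1 := Laplace_sinh_parts _ _ z D1 (exp_growth_mult _ _ (exp_growth_const nu) Gs)
     (exp_growth_mult _ _ (exp_growth_const (nu * nu)) Gi) Hz). cbv beta in P1.
  rewrite (Laplace_sinh_scal (nu * nu)) in P1 by trivial.
  assert (P2 := Laplace_sinh_parts _ _ z D2 (exp_growth_mult _ _ exp_growth_cosh Gi)
     (exp_growth_plus _ _ Gsi (exp_growth_plus _ _ Gcs Gp)) Hz). cbv beta in P2.
  rewrite !Laplace_sinh_plus in P2 by (trivial; now apply exp_growth_plus).
  rewrite (Laplace_sinh_ext (fun t => cosh t * (cosh t * cosh_conv b nu t))
    (fun t => cosh_conv b nu t + sinh t * (sinh t * cosh_conv b nu t))) in P2.
  2: { intros t. replace (cosh t * (cosh t * cosh_conv b nu t))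
         with ((cosh t * cosh t) * cosh_conv b nu t) by ring.
       replace (cosh t * cosh t) with (1 + sinh t * sinh t); [ring|].
       unfold cosh, sinh. assert (E : exp t * exp (- t) = 1)
         by (rewrite <- exp_plus, <- exp_0; f_equal; ring).
       apply Rminus_diag_uniq. transitivity (1 - exp t * exp (- t)); [field|lra]. }
  rewrite Laplace_sinh_plus in P2 by trivial.
  fold (Gamma_Laplace b z) in P2.
  assert (S0 : sinh_conv b nu 0 = 0) by (unfold sinh_conv; rewrite !exp_conv_0; ring).
  assert (C0 : cosh_conv b nu 0 = 0) by (unfold cosh_conv; rewrite !exp_conv_0; ring).
  rewrite S0, Rmult_0_r in P1. rewrite C0, Rmult_0_r in P2.
  set (H := Laplace_sinh (cosh_conv b nu) z) in *.
  set (H1 := Laplace_sinh (fun t => sinh t * cosh_conv b nu t) z) in *.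
  set (H2 := Laplace_sinh (fun t => sinh t * (sinh t * cosh_conv b nu t)) z) in *.
  set (T := Laplace_sinh (fun t => cosh t * (nu * sinh_conv b nu t)) z) in *.
  rewrite RtoC_mult in P1.
  transitivity ((z * (z * (H + H2)) - z * H1 - nu * nu * H) / z ^ 2)%C; [field; trivial|].
  rewrite P2. replace (nu * nu * H)%C with (z * T)%C by (rewrite P1; ring).
  field. trivial.
Qed.

(** * The pointwise inequality behind the positivity of [theta] *)

Lemma cosh_plus_minus (x y : R) :
  cosh x * cosh (x + y) - sinh x * sinh (x + y) = cosh y /\
  cosh x * sinh (x + y) - sinh x * cosh (x + y) = sinh y.
Proof.
  unfold cosh, sinh. rewrite Ropp_plus_distr, !exp_plus.
  assert (E : exp x * exp (- x) = 1) by (rewrite <- exp_plus, <- exp_0; f_equal; ring).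
  split.
  - transitivity (exp x * exp (- x) * ((exp y + exp (- y)) / 2)); [field|rewrite E; ring].
  - transitivity (exp x * exp (- x) * ((exp y - exp (- y)) / 2)); [field|rewrite E; ring].
Qed.

Lemma cosh_gt_0 (x : R) : 0 < cosh x.
Proof. unfold cosh. generalize (exp_pos x) (exp_pos (- x)). lra. Qed.

Lemma sinh_gt_0 (x : R) : 0 < x -> 0 < sinh x.
Proof. intros H. rewrite <- sinh_0. now apply sinh_lt. Qed.

Lemma mult_sinh_ge_0 (nu r : R) : 0 <= r -> 0 <= nu * sinh (nu * r).
Proof.
  intros Hr. destruct (Rle_dec 0 nu) as [H|H].
  - apply Rmult_le_pos; trivial. apply sinh_ge_0. nra.
  - replace (nu * sinh (nu * r)) with ((- nu) * sinh ((- nu) * r)).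
    + apply Rmult_le_pos; [lra|]. apply sinh_ge_0. nra.
    + unfold sinh. replace (- nu * r) with (- (nu * r)) by ring. rewrite Ropp_involutive. field.
Qed.

(* With [c] the integral of the convolution over [0, r] instead of [0, t], the
   function
     [(b cosh (nu (t - r)) cosh t + nu sinh (nu (t - r)) sinh t) sinh^b r
        - (b^2 - nu^2) sinh t c]
   vanishes at [r = 0], has a positive derivative and equals the difference of
   the two sides at [r = t]. *)
Lemma cosh_conv_lt (b nu t : R) : 0 < b -> 0 < t ->
  (b ^ 2 - nu ^ 2) * (sinh t * cosh_conv b nu t) < b * (cosh t * pos_power b (sinh t)).
Proof.
  intros Hb Ht.
  pose (A := fun nu r => RInt (fun r => exp (- nu * r) * pos_power b (sinh r)) 0 r).
  assert (DA : forall nu r, is_derive (A nu) r (exp (- nu * r) * pos_power b (sinh r))).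
  { intros m r. apply (is_derive_RInt_0 (fun r => exp (- m * r) * pos_power b (sinh r))).
    intros s. now apply continuous_exp_conv_integrand. }
  pose (Q := fun r => b * cosh t * cosh (nu * (t - r)) + nu * sinh t * sinh (nu * (t - r))).
  pose (Q' := fun r => - b * nu * cosh t * sinh (nu * (t - r)) - nu ^ 2 * sinh t * cosh (nu * (t - r))).
  assert (DQ : forall r, is_derive Q r (Q' r)).
  { intros r. unfold Q, Q'.
    assert (D : is_derive (fun r => nu * (t - r)) r (- nu)) by (auto_derive; trivial; ring).
    evar_last.
    - apply @is_derive_plus; apply is_derive_scal.
      + apply (is_derive_comp cosh (fun r => nu * (t - r))); [apply is_derive_cosh|exact D].
      + apply (is_derive_comp sinh (fun r => nu * (t - r))); [apply is_derive_sinh|exact D].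
    - unfold plus, scal; simpl; unfold mult; simpl. ring. }
  pose (c := (b ^ 2 - nu ^ 2) * sinh t / 2).
  pose (J := fun r => pos_power b (sinh r) * Q r -
      (c * exp (nu * t) * A nu r + c * exp (- nu * t) * A (- nu) r)).
  pose (J' := fun r => b * pos_power (b - 1) (sinh r) *
      (b * cosh (nu * (t - r)) * cosh (t - r) + nu * sinh (nu * (t - r)) * sinh (t - r))).
  assert (DC : forall r, is_derive (fun r => c * exp (nu * t) * A nu r + c * exp (- nu * t) * A (- nu) r) r
      ((b ^ 2 - nu ^ 2) * sinh t * cosh (nu * (t - r)) * pos_power b (sinh r))).
  { intros r. evar_last.
    - apply @is_derive_plus; apply is_derive_scal; apply DA.
    - unfold plus; simpl. unfold c, cosh.
      replace (nu * (t - r)) with (nu * t + - nu * r) by ring.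
      replace (- (nu * t + - nu * r)) with (- nu * t + - - nu * r) by ring.
      rewrite !exp_plus. field. }
  assert (DJ : forall r, 0 < r < t -> is_derive J r (J' r)).
  { intros r Hr. assert (Ps := sinh_gt_0 r (proj1 Hr)). evar_last.
    - apply @is_derive_minus; [|apply DC].
      apply (is_derive_mult (fun r => pos_power b (sinh r)) Q); [|apply DQ|apply Rmult_comm].
      apply (is_derive_comp (pos_power b) sinh); [now apply is_derive_pos_power|apply is_derive_sinh].
    - unfold minus, plus, opp, scal, mult; simpl. unfold mult; simpl.
      (* Once [sinh^(b - 1) r] is factored out, the terms in [nu^2] cancel. The addition formulas
         then turn the remaining products into [cosh (t - r)] and [sinh (t - r)]. *)
      replace (pos_power b (sinh r)) with (sinh r * pos_power (b - 1) (sinh r))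
        by (rewrite pos_power_succ; f_equal; ring).
      destruct (cosh_plus_minus r (t - r)) as [E1 E2].
      replace (r + (t - r)) with t in E1, E2 by ring.
      unfold J', Q, Q'. rewrite <- E1 at 1. rewrite <- E2. ring. }
  assert (CJ : forall r, continuous J r).
  { intros r. apply (continuous_minus (V := R_NormedModule) (fun r => pos_power b (sinh r) * Q r)).
    - apply (continuous_mult (fun r => pos_power b (sinh r)) Q).
      + now apply continuous_pos_power_sinh.
      + eapply continuous_of_is_derive, DQ.
    - eapply continuous_of_is_derive, DC. }
  assert (PJ : forall r, 0 < r <= t -> 0 < J' r).
  { intros r Hr. unfold J'.
    assert (0 < pos_power (b - 1) (sinh r)) by apply pos_power_gt_0, sinh_gt_0, Hr.
    assert (0 < b * cosh (nu * (t - r)) * cosh (t - r))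
      by (apply Rmult_lt_0_compat; [apply Rmult_lt_0_compat; trivial|]; apply cosh_gt_0).
    assert (0 <= nu * sinh (nu * (t - r)) * sinh (t - r))
      by (apply Rmult_le_pos; [apply mult_sinh_ge_0|apply sinh_ge_0]; lra).
    apply Rmult_lt_0_compat; nra. }
  (* The mean value point lies in a closed interval and may be 0, where [J'] need not be the
     derivative of [J]; the truncated power gives it the harmless value 0. Strict growth is
     therefore taken from [[t/2, t]] only. *)
  assert (J0 : J' 0 = 0).
  { unfold J'. rewrite sinh_0, pos_power_0 by lra. ring. }
  assert (I1 : J 0 <= J (t / 2)).
  { destruct (MVT_gen J 0 (t / 2) J') as (r & Hr & E).
    - intros r Hr. apply DJ. rewrite Rmin_left, Rmax_right in Hr; lra.
    - intros r _. apply continuity_pt_filterlim, CJ.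
    - rewrite Rmin_left, Rmax_right in Hr by lra.
      assert (0 <= J' r) by (destruct (Req_dec r 0) as [->|]; [lra|left; apply PJ; lra]).
      nra. }
  assert (I2 : J (t / 2) < J t).
  { destruct (MVT_gen J (t / 2) t J') as (r & Hr & E).
    - intros r Hr. apply DJ. rewrite Rmin_left, Rmax_right in Hr; lra.
    - intros r _. apply continuity_pt_filterlim, CJ.
    - rewrite Rmin_left, Rmax_right in Hr by lra.
      assert (0 < J' r) by (apply PJ; lra). nra. }
  assert (Z : J 0 = 0).
  { unfold J, A. rewrite sinh_0, pos_power_0, !RInt_point by lra. unfold zero; simpl. ring. }
  assert (E : J t = b * (cosh t * pos_power b (sinh t)) - (b ^ 2 - nu ^ 2) * (sinh t * cosh_conv b nu t)).
  { unfold J, Q. replace (t - t) with 0 by ring. rewrite Rmult_0_r, cosh_0, sinh_0.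
    unfold cosh_conv, exp_conv. fold (A nu t). fold (A (- nu) t). unfold c. field. }
  lra.
Qed.

Lemma cosh_conv_gt_0 (b nu t : R) : 0 < b -> 0 < t -> 0 < cosh_conv b nu t.
Proof.
  intros Hb Ht.
  assert (H : forall m, 0 < exp_conv b m t).
  { intros m. apply Rmult_lt_0_compat; [apply exp_pos|].
    apply RInt_gt_0; trivial.
    - intros r Hr. apply Rmult_lt_0_compat; [apply exp_pos|]. apply pos_power_gt_0, sinh_gt_0, Hr.
    - intros r _. now apply continuous_exp_conv_integrand. }
  unfold cosh_conv. generalize (H nu) (H (- nu)). lra.
Qed.

(** * Uniqueness for Bessel's equation *)

Lemma is_Cderive_along_real (f : C -> C) (l : C) (t : R) : is_Cderive f t l ->
  is_derive (fun t : R => Re (f t)) t (Re l) /\ is_derive (fun t : R => Im (f t)) t (Im l).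
Proof.
  intros H. assert (E : forall t : R, (0 + t * 1)%C = t) by (intros; ring).
  destruct (is_Cderive_along_Re f 0 1 l t) as [H1 H2]; [now rewrite E|].
  rewrite Cmult_1_l in H1, H2.
  split; eapply is_derive_ext; [|exact H1| |exact H2]; intros s; cbv beta; now rewrite E.
Qed.

Lemma is_Cderive_along_vertical (f : C -> C) (l : C) (x t : R) : is_Cderive f (x + t * Ci) l ->
  is_derive (fun t : R => Re (f (x + t * Ci)%C)) t (- Im l) /\
  is_derive (fun t : R => Im (f (x + t * Ci)%C)) t (Re l).
Proof.
  intros H. destruct (is_Cderive_along_Re f x Ci l t H) as [H1 H2].
  destruct l as [a b].
  replace (- Im (a, b)) with (Re (Ci * (a, b))%C) by (unfold Re, Im, Ci; simpl; ring).
  replace (Re (a, b)) with (Im (Ci * (a, b))%C) by (unfold Re, Im, Ci; simpl; ring).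
  now split.
Qed.

(** * Exponential growth against polynomial bounds *)

Lemma nondecreasing_of_derive (f df : R -> R) (a b : R) : a <= b ->
  (forall t, a <= t <= b -> is_derive f t (df t)) ->
  (forall t, a <= t <= b -> 0 <= df t) -> f a <= f b.
Proof.
  intros Hab Hd Hp. destruct (MVT_gen f a b df) as (c & Hc & E).
  - intros t Ht. rewrite Rmin_left, Rmax_right in Ht by trivial. apply Hd. lra.
  - intros t Ht. rewrite Rmin_left, Rmax_right in Ht by trivial.
    apply continuity_pt_filterlim. eapply continuous_of_is_derive. now apply Hd.
  - rewrite Rmin_left, Rmax_right in Hc by trivial. specialize (Hp c Hc). nra.
Qed.

Lemma exp_beats_power (n : nat) (A M : R) : exists y, 0 <= y /\ M * (A + y) ^ n < exp y.
Proof.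
  (* With [y = k w], [exp y = (exp w)^(n + 1) >= w^(n + 1)], while the other side is at most
     [B w^n]; [w] is chosen above [B], and above [|A|] so that [|A + y| <= 2 k w]. *)
  pose (k := INR (S n)). assert (Hk : 1 <= k) by (unfold k; rewrite S_INR; generalize (pos_INR n); lra).
  pose (B := Rabs M * (2 * k) ^ n).
  assert (PB : 0 <= B) by (apply Rmult_le_pos; [apply Rabs_pos|apply pow_le; lra]).
  pose (w := B + Rabs A + 1).
  assert (PA := Rabs_pos A). assert (Hw : 1 <= w) by (unfold w; lra).
  exists (k * w). split; [nra|].
  apply Rle_lt_trans with (Rabs M * (2 * k * w) ^ n).
  - apply Rle_trans with (1 := Rle_abs _). rewrite Rabs_mult.
    apply Rmult_le_compat_l; [apply Rabs_pos|]. rewrite <- RPow_abs. apply pow_incr.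
    split; [apply Rabs_pos|]. apply Rle_trans with (1 := Rabs_triang _ _).
    rewrite (Rabs_pos_eq (k * w)) by nra. unfold w in *. nra.
  - rewrite Rpow_mult_distr, <- Rmult_assoc. fold B.
    apply Rlt_le_trans with (w ^ S n).
    + simpl. assert (0 < w ^ n) by (apply pow_lt; lra). unfold w at 2. nra.
    + replace (exp (k * w)) with (exp w ^ S n).
      * apply pow_incr. generalize (exp_ineq1_le w). lra.
      * rewrite <- Rpower_pow by apply exp_pos. unfold Rpower. now rewrite ln_exp.
Qed.

(* [q' + q] grows at least like [exp y], hence so does [q]. *)
Lemma convex_growth_aux (q q' q'' : R -> R) : (forall y, is_derive q y (q' y)) ->
  (forall y, is_derive q' y (q'' y)) -> (forall y, q y <= q'' y) -> 0 <= q' 0 -> 0 <= q 0 ->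
  forall y, 0 <= y -> q 0 / 2 * exp y <= q y.
Proof.
  intros D1 D2 Hq H1 H0 y Hy.
  assert (A : forall t, 0 <= t -> q 0 * exp t <= q' t + q t).
  { intros t Ht.
    pose (f := fun t => (q' t + q t) * exp (- t)).
    assert (H : f 0 <= f t).
    { apply nondecreasing_of_derive with (fun t => (q'' t - q t) * exp (- t)); trivial.
      - intros s _. evar_last.
        + apply (is_derive_mult (fun t => q' t + q t) (fun t => exp (- t))); [| |apply Rmult_comm].
          * apply @is_derive_plus; [apply D2|apply D1].
          * auto_derive; trivial.
        + unfold plus, mult; simpl. ring.
      - intros s _. apply Rmult_le_pos; [specialize (Hq s); lra|left; apply exp_pos]. }
    unfold f in H. rewrite Ropp_0, exp_0 in H.
    apply (Rmult_le_compat_r (exp t)) in H; [|left; apply exp_pos].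
    rewrite (Rmult_assoc (q' t + q t)), <- exp_plus, Rplus_opp_l, exp_0 in H.
    generalize (exp_pos t). nra. }
  (* [(q e^t)' = (q' + q) e^t >= q 0 e^(2 t)], whose integration produces the factor 1/2. *)
  pose (f := fun t => q t * exp t - q 0 / 2 * exp (2 * t)).
  assert (H : f 0 <= f y).
  { apply nondecreasing_of_derive with (fun t => (q' t + q t - q 0 * exp t) * exp t); trivial.
    - intros s _. evar_last.
      + apply @is_derive_minus.
        * apply (is_derive_mult q exp); [apply D1| |apply Rmult_comm]. auto_derive; trivial.
        * auto_derive; trivial.
      + unfold minus, plus, opp, mult; simpl.
        replace (2 * s) with (s + s) by ring. rewrite exp_plus. field.
    - intros s [Hs _]. apply Rmult_le_pos; [specialize (A s Hs); lra|left; apply exp_pos]. }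
  unfold f in H. rewrite Rmult_0_r, exp_0 in H. replace (2 * y) with (y + y) in H by ring.
  rewrite exp_plus in H. apply Rmult_le_reg_r with (exp y); [apply exp_pos|lra].
Qed.

(** If [q 0 > 0], then [q] grows exponentially to the right when [q' 0 >= 0], and to the left
    otherwise, by reflection. The direction is not known in advance, so the polynomial bound is
    two-sided. *)
Lemma convex_growth_0 (q q' q'' : R -> R) (A M : R) (n : nat) :
  (forall y, is_derive q y (q' y)) -> (forall y, is_derive q' y (q'' y)) ->
  (forall y, q y <= q'' y) -> (forall y, 0 <= q y) ->
  (forall y, q y <= M * (A + Rabs y) ^ n) -> q 0 = 0.
Proof.
  intros D1 D2 Hq H0 HM.
  destruct (H0 0) as [P|]; [exfalso|auto].
  destruct (exp_beats_power n A (2 * M / q 0)) as (y & Hy & L).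
  assert (K : q 0 / 2 * exp y <= M * (A + y) ^ n).
  { destruct (Rle_dec 0 (q' 0)) as [H|H].
    - apply Rle_trans with (1 := convex_growth_aux q q' q'' D1 D2 Hq H (H0 0) y Hy).
      rewrite <- (Rabs_pos_eq y) at 2 by trivial. apply HM.
    - assert (N : forall y, is_derive Ropp y (-1)) by (intros; auto_derive; trivial; ring).
      assert (G := convex_growth_aux (fun y => q (- y)) (fun y => - q' (- y)) (fun y => q'' (- y))).
      cbv beta in G. rewrite Ropp_0 in G.
      apply Rle_trans with (q (- y)).
      + apply G; trivial; try lra.
        * intros s. evar_last; [apply (is_derive_comp q Ropp); [apply D1|apply N]|].
          unfold scal; simpl; unfold mult; simpl. ring.
        * intros s. evar_last; [apply @is_derive_opp, (is_derive_comp q' Ropp); [apply D2|apply N]|].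
          unfold opp, scal; simpl; unfold mult; simpl. ring.
      + rewrite <- (Rabs_pos_eq y) at 2 by trivial. rewrite <- (Rabs_Ropp y). apply HM. }
  apply (Rmult_lt_compat_l (q 0 / 2)) in L; [|lra].
  replace (q 0 / 2 * (2 * M / q 0 * (A + y) ^ n)) with (M * (A + y) ^ n) in L by (field; lra). lra.
Qed.

Lemma Re_Im_Cauchy_Schwarz (a b : C) : Rabs (Re a * Re b + Im a * Im b) <= Cmod a * Cmod b.
Proof.
  replace (Re a * Re b + Im a * Im b) with (Re (Cconj a * b)%C)
    by (destruct a, b; unfold Cconj, Re, Im; simpl; ring).
  apply Rle_trans with (1 := re_le_Cmod _). rewrite Cmod_mult, Cmod_conj. lra.
Qed.


(* On a vertical line far to the right the oscillation of Bessel functions becomes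
   exponential growth: there [q = |h|^2] satisfies [q'' >= q]. *)
Lemma bessel_vertical_0 (nu : R) (h h1 h2 : C -> C) (x M : R) (n : nat) :
  (forall z, 0 < Re z -> is_Cderive h z (h1 z)) ->
  (forall z, 0 < Re z -> is_Cderive h1 z (h2 z)) ->
  (forall z, 0 < Re z -> (h2 z + 1 / z * h1 z + (1 - nu ^ 2 / z ^ 2) * h z = 0)%C) ->
  0 < x -> 1 + 2 * nu ^ 2 <= x ^ 2 ->
  (forall z, Re z = x -> Cmod (h z) <= M * Cmod z ^ n) -> h x = 0.
Proof.
  intros D1 D2 HE Hx Hx2 HM.
  assert (Rx : forall y : R, Re (x + y * Ci)%C = x) by (intros; unfold Re, Ci; simpl; ring).
  assert (Px : forall y : R, 0 < Re (x + y * Ci)%C) by (intros; now rewrite Rx).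
  pose (q := fun y : R => Re (h (x + y * Ci)%C) * Re (h (x + y * Ci)%C)
     + Im (h (x + y * Ci)%C) * Im (h (x + y * Ci)%C)).
  (* Along the line [d/dy] is [i] times the complex derivative. So [q' = 2 Re (i conj(h) h1)], and
     [q'' = 2 (|h1|^2 - Re (conj(h) h2))]. *)
  pose (q' := fun y : R => 2 * (Im (h (x + y * Ci)%C) * Re (h1 (x + y * Ci)%C)
     - Re (h (x + y * Ci)%C) * Im (h1 (x + y * Ci)%C))).
  pose (q'' := fun y : R => 2 * (Cmod (h1 (x + y * Ci)%C) ^ 2
     - (Re (h (x + y * Ci)%C) * Re (h2 (x + y * Ci)%C) + Im (h (x + y * Ci)%C) * Im (h2 (x + y * Ci)%C)))).
  assert (Eq : forall y, q y = Cmod (h (x + y * Ci)%C) ^ 2)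
    by (intros; rewrite Cmod2_alt; unfold q; ring).
  assert (Z : q 0 = 0).
  { apply (convex_growth_0 q q' q'' x (M ^ 2) (n + n)).
    - intros y. destruct (is_Cderive_along_vertical h _ x y (D1 _ (Px y))) as [A B].
      unfold q. evar_last.
      + apply @is_derive_plus.
        * apply (is_derive_mult (fun y : R => Re (h (x + y * Ci)%C)) (fun y : R => Re (h (x + y * Ci)%C)));
            [exact A|exact A|apply Rmult_comm].
        * apply (is_derive_mult (fun y : R => Im (h (x + y * Ci)%C)) (fun y : R => Im (h (x + y * Ci)%C)));
            [exact B|exact B|apply Rmult_comm].
      + unfold q', plus, mult; simpl. ring.
    - intros y. destruct (is_Cderive_along_vertical h _ x y (D1 _ (Px y))) as [A B].
      destruct (is_Cderive_along_vertical h1 _ x y (D2 _ (Px y))) as [A1 B1].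
      unfold q'. evar_last.
      + apply is_derive_scal. apply @is_derive_minus.
        * apply (is_derive_mult (fun y : R => Im (h (x + y * Ci)%C)) (fun y : R => Re (h1 (x + y * Ci)%C)));
            [exact B|exact A1|apply Rmult_comm].
        * apply (is_derive_mult (fun y : R => Re (h (x + y * Ci)%C)) (fun y : R => Im (h1 (x + y * Ci)%C)));
            [exact A|exact B1|apply Rmult_comm].
      + unfold q'', minus, opp, plus, mult; simpl. rewrite Rmult_1_r.
        replace (Cmod _ * Cmod _) with (Cmod (h1 (x + y * Ci)%C) ^ 2) by ring.
        rewrite Cmod2_alt. ring.
    - intros y. rewrite Eq. unfold q''.
      specialize (HE _ (Px y)). assert (Lz := re_le_Cmod (x + y * Ci)%C). rewrite Rx, Rabs_pos_eq in Lz by lra.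
      assert (Hz0 := Re_pos_neq_0 _ (Px y)).
      set (z := (x + y * Ci)%C) in *.
      (* [k] collects the lower-order terms: [h2 = k - h], and the [- h] contributes [2 |h|^2] to
         [q'']. *)
      set (k := (nu ^ 2 / z ^ 2 * h z - 1 / z * h1 z)%C).
      assert (E : h2 z = (k - h z)%C).
      { unfold k. transitivity (h2 z - 0)%C; [ring|]. rewrite <- HE. ring. }
      assert (Bk : Cmod k <= nu ^ 2 / x ^ 2 * Cmod (h z) + / x * Cmod (h1 z)).
      { unfold k, Cminus. apply Rle_trans with (1 := Cmod_triangle _ _).
        rewrite Cmod_opp, !Cmod_mult, !Cmod_div, !Cmod_pow, Cmod_1, Cmod_R, pow2_abs
          by (trivial; now apply Cpow_nz).
        assert (Pz : 0 < Cmod z) by lra.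
        apply Rplus_le_compat; (apply Rmult_le_compat_r; [apply Cmod_ge_0|]).
        - apply Rmult_le_compat_l; [apply pow2_ge_0|]. apply Rinv_le_contravar; nra.
        - unfold Rdiv. rewrite Rmult_1_l. now apply Rinv_le_contravar. }
      assert (CS := Re_Im_Cauchy_Schwarz (h z) k). apply Rabs_le_between in CS.
      rewrite E.
      replace (Re (h z) * Re (k - h z)%C + Im (h z) * Im (k - h z)%C)
        with (Re (h z) * Re k + Im (h z) * Im k - Cmod (h z) ^ 2)
        by (rewrite Cmod2_alt; destruct (h z), k; unfold Re, Im; simpl; ring).
      assert (P0 := Cmod_ge_0 (h z)). assert (P1 := Cmod_ge_0 (h1 z)).
      set (a := Cmod (h z)) in *. set (b := Cmod (h1 z)) in *.
      assert (Q1 : a * Cmod k <= nu ^ 2 / x ^ 2 * a ^ 2 + / x * b * a).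
      { apply Rle_trans with (a * (nu ^ 2 / x ^ 2 * a + / x * b)); [now apply Rmult_le_compat_l|right; ring]. }
      (* The weights let the cross term be absorbed by exactly the available [2 |h1|^2]. What
         remains, [(1/2 + 2 nu^2) |h|^2 / x^2], is at most [|h|^2] by the lower bound on [x]. *)
      assert (Q2 : 2 * (/ x * b * a) <= 2 * b ^ 2 + / 2 * (/ x ^ 2 * a ^ 2)).
      { assert (S := pow2_ge_0 (2 * b - / x * a)).
        replace (/ x ^ 2 * a ^ 2) with ((/ x * a) ^ 2) by (field; lra). nra. }
      assert (Q3 : (/ 2 + 2 * nu ^ 2) * (/ x ^ 2 * a ^ 2) <= a ^ 2).
      { assert (I : 0 < x ^ 2) by nra.
        apply Rmult_le_reg_l with (x ^ 2); trivial.
        replace (x ^ 2 * ((/ 2 + 2 * nu ^ 2) * (/ x ^ 2 * a ^ 2))) with ((/ 2 + 2 * nu ^ 2) * a ^ 2) by (field; lra).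
        apply Rmult_le_compat_r; [apply pow2_ge_0|lra]. }
      replace (nu ^ 2 / x ^ 2 * a ^ 2) with (nu ^ 2 * (/ x ^ 2 * a ^ 2)) in Q1 by (unfold Rdiv; ring).
      lra.
    - intros y. rewrite Eq. apply pow2_ge_0.
    - intros y. rewrite Eq. specialize (HM _ (Rx y)).
      apply Rle_trans with ((M * Cmod (x + y * Ci)%C ^ n) ^ 2).
      { apply pow_incr. split; [apply Cmod_ge_0|trivial]. }
      rewrite Rpow_mult_distr, <- pow_mult, Nat.mul_comm. simpl (2 * n)%nat. rewrite Nat.add_0_r.
      apply Rmult_le_compat_l; [apply pow2_ge_0|]. apply pow_incr. split; [apply Cmod_ge_0|].
      apply Rle_trans with (1 := Cmod_triangle _ _).
      rewrite Cmod_mult, Cmod_Ci, !Cmod_R, (Rabs_pos_eq x) by lra. lra. }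
  rewrite Eq in Z. replace (x + 0%R * Ci)%C with (RtoC x) in Z by ring.
  apply Cmod_eq_0. nra.
Qed.

(* Gronwall for [|h|^2 + |h'|^2]. *)
Lemma bessel_unique_backwards (nu : R) (h h1 h2 : C -> C) (x X : R) :
  (forall z, 0 < Re z -> is_Cderive h z (h1 z)) ->
  (forall z, 0 < Re z -> is_Cderive h1 z (h2 z)) ->
  (forall z, 0 < Re z -> (h2 z + 1 / z * h1 z + (1 - nu ^ 2 / z ^ 2) * h z = 0)%C) ->
  0 < x <= X -> h X = 0 -> h1 X = 0 -> h1 x = 0.
Proof.
  intros D1 D2 HE Hx Z0 Z1.
  (* In [e'] the [- h] contained in [h2] cancels the product of [h] and [h1]. There remain
     [- 2 |h1|^2 / t] and [2 nu^2 / t^2] times that product; on [[x, X]] both are controlled by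
     [K e], so [e' + K e >= 0]. *)
  pose (K := 2 / x + nu ^ 2 / x ^ 2).
  pose (e := fun t : R => (Re (h t) * Re (h t) + Im (h t) * Im (h t)) + (Re (h1 t) * Re (h1 t) + Im (h1 t) * Im (h1 t))).
  pose (e' := fun t : R => 2 * (Re (h t) * Re (h1 t) + Im (h t) * Im (h1 t)) + 2 * (Re (h1 t) * Re (h2 t) + Im (h1 t) * Im (h2 t))).
  pose (f := fun t => e t * exp (K * t)).
  assert (H : f x <= f X).
  { apply nondecreasing_of_derive with (fun t => (e' t + K * e t) * exp (K * t)); [lra| |].
    - intros t Ht. assert (Pt : 0 < Re t) by (simpl; lra).
      destruct (is_Cderive_along_real h _ t (D1 _ Pt)) as [A B].
      destruct (is_Cderive_along_real h1 _ t (D2 _ Pt)) as [A1 B1].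
      evar_last.
      + apply (is_derive_mult e (fun t => exp (K * t))); [|auto_derive; trivial|apply Rmult_comm].
        apply @is_derive_plus; apply @is_derive_plus.
        * apply (is_derive_mult (fun t : R => Re (h t)) (fun t : R => Re (h t))); [exact A|exact A|apply Rmult_comm].
        * apply (is_derive_mult (fun t : R => Im (h t)) (fun t : R => Im (h t))); [exact B|exact B|apply Rmult_comm].
        * apply (is_derive_mult (fun t : R => Re (h1 t)) (fun t : R => Re (h1 t))); [exact A1|exact A1|apply Rmult_comm].
        * apply (is_derive_mult (fun t : R => Im (h1 t)) (fun t : R => Im (h1 t))); [exact B1|exact B1|apply Rmult_comm].
      + unfold e', plus, mult; simpl. ring.
    - intros t Ht. apply Rmult_le_pos; [|left; apply exp_pos].
      assert (Pt : 0 < Re t) by (simpl; lra). assert (Hz0 := Re_pos_neq_0 _ Pt).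
      specialize (HE _ Pt).
      assert (E : h2 t = (RtoC (- / t) * h1 t + RtoC (nu ^ 2 * / t ^ 2 - 1) * h t)%C).
      { transitivity (h2 t - 0)%C; [ring|]. rewrite <- HE.
        rewrite RtoC_opp, RtoC_minus, RtoC_mult, !RtoC_inv, !RtoC_pow by nra. field. trivial. }
      unfold e', e. rewrite E.
      assert (I1 : / t <= / x) by (apply Rinv_le_contravar; lra).
      assert (I0 : 0 < / t) by (apply Rinv_0_lt_compat; lra).
      assert (I2 : / t ^ 2 <= / x ^ 2) by (apply Rinv_le_contravar; nra).
      assert (I3 : 0 < / t ^ 2) by (apply Rinv_0_lt_compat; nra).
      set (p := / t ^ 2) in *. set (r := / t) in *.
      unfold K, Rdiv. set (P := / x ^ 2) in *. set (R0 := / x) in *.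
      destruct (h t) as [a b], (h1 t) as [c d]. unfold Re, Im; simpl.
      assert (S1 := pow2_ge_0 (a + c)). assert (S2 := pow2_ge_0 (b + d)).
      assert (N := pow2_ge_0 nu).
      assert (T1 : 0 <= (R0 - r) * (c ^ 2 + d ^ 2)) by (apply Rmult_le_pos; [lra|nra]).
      assert (T2 : 0 <= R0 * (a ^ 2 + b ^ 2)) by (apply Rmult_le_pos; [lra|nra]).
      assert (T3 : 0 <= nu ^ 2 * (P - p) * (a ^ 2 + b ^ 2 + c ^ 2 + d ^ 2))
        by (apply Rmult_le_pos; [apply Rmult_le_pos; lra|nra]).
      assert (T4 : 0 <= nu ^ 2 * p * ((a + c) ^ 2 + (b + d) ^ 2))
        by (apply Rmult_le_pos; [apply Rmult_le_pos; lra|nra]).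
      nra. }
  unfold f in H. unfold e at 2 in H. rewrite Z0, Z1 in H. simpl in H.
  assert (N : e x <= 0).
  { apply Rmult_le_reg_r with (exp (K * x)); [apply exp_pos|lra]. }
  unfold e in N.
  apply Cmod_eq_0. assert (Q := Cmod2_alt (h1 x)).
  assert (Cmod (h1 x) ^ 2 <= 0) by (rewrite Q; nra).
  generalize (Cmod_ge_0 (h1 x)). nra.
Qed.

(** Every vertical line far enough to the right gives one real zero of [h]. Hence [h] vanishes on a
    real half-line, where [h1] does too, and the energy estimate carries this back to any [x > 0].
    Only [h1] is concluded on, since the derivative of the Lommel function is what is wanted. *)
Lemma bessel_unique (nu : R) (h h1 h2 : C -> C) (X M : R) (n : nat) :
  (forall z, 0 < Re z -> is_Cderive h z (h1 z)) ->
  (forall z, 0 < Re z -> is_Cderive h1 z (h2 z)) ->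
  (forall z, 0 < Re z -> (h2 z + 1 / z * h1 z + (1 - nu ^ 2 / z ^ 2) * h z = 0)%C) ->
  (forall z, X <= Re z -> Cmod (h z) <= M * Cmod z ^ n) ->
  forall x : R, 0 < x -> h1 x = 0.
Proof.
  intros D1 D2 HE HM x Hx.
  (* As [1 + 2 nu^2 >= 1], having [y] above it also puts [y^2] above it, as the vertical argument
     requires. *)
  pose (Y := Rmax (Rmax X x) (1 + 2 * nu ^ 2)).
  assert (Y1 : X <= Y) by (eapply Rle_trans; [apply Rmax_l|apply Rmax_l]).
  assert (Y2 : x <= Y) by (eapply Rle_trans; [apply Rmax_r|apply Rmax_l]).
  assert (Y3 : 1 + 2 * nu ^ 2 <= Y) by apply Rmax_r.
  assert (N := pow2_ge_0 nu).
  assert (Z : forall y : R, Y <= y -> h y = 0).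
  { intros y Hy. apply (bessel_vertical_0 nu h h1 h2 y M n); trivial; try nra.
    intros z Hz. apply HM. lra. }
  (* At [Y + 1], unlike at [Y], [h] is known to vanish on both sides, which gives [h1 = 0]. *)
  apply (bessel_unique_backwards nu h h1 h2 x (Y + 1)); trivial; try lra.
  - apply Z. lra.
  - assert (PY : 0 < Re (RtoC (Y + 1))) by (simpl; lra).
    destruct (is_Cderive_along_real h _ (Y + 1) (D1 _ PY)) as [A B].
    assert (U : forall p : C -> R, p 0 = 0 -> forall l, is_derive (fun t : R => p (h t)) (Y + 1) l -> l = 0).
    { intros p Hp l Hl. apply is_derive_unique in Hl. rewrite <- Hl.
      rewrite (Derive_ext_loc _ (fun _ => 0)); [apply Derive_const|].
      exists (mkposreal 1 Rlt_0_1). intros t Ht. change (Rabs (t - (Y + 1)) < 1) in Ht.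
      apply Rabs_def2 in Ht. rewrite Z by lra. exact Hp. }
    apply injective_projections; [apply (U Re)|apply (U Im)]; trivial.
Qed.

(** * Expansion of the Lommel function *)

Definition lommel_coef (mu nu : R) (n : nat) : C := ((-1) ^ n * lommel_a (- mu) nu n)%C.

Definition lommel_expo (mu : R) (n : nat) : R := mu - 1 - INR (2 * n).

(** The exponent [mu - 1 - 2 n] is the opposite of [- mu + 2 (n + 1) - 1], so the new factor of
    [lommel_a] is exactly what the Lommel operator produces from the power with that exponent. *)
Lemma lommel_coef_succ (mu nu : R) (n : nat) :
  lommel_coef mu nu (S n) = (- (lommel_expo mu n ^ 2 - nu ^ 2)%R * lommel_coef mu nu n)%C.
Proof.
  unfold lommel_coef, lommel_expo. cbn [lommel_a Cpow].
  rewrite S_INR, mult_INR. simpl (INR 2).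
  rewrite RtoC_minus, !RtoC_pow, !RtoC_minus, RtoC_mult, !RtoC_plus. ring.
Qed.

Definition lommel_sum (mu nu : R) (M : nat) (z : C) : C :=
  Csum (fun n => lommel_coef mu nu n * Cppow z (lommel_expo mu n))%C M.
Definition lommel_sum1 (mu nu : R) (M : nat) (z : C) : C :=
  Csum (fun n => lommel_coef mu nu n * lommel_expo mu n * Cppow z (lommel_expo mu n - 1)%R)%C M.
Definition lommel_sum2 (mu nu : R) (M : nat) (z : C) : C :=
  Csum (fun n => lommel_coef mu nu n * lommel_expo mu n * (lommel_expo mu n - 1)%R
     * Cppow z (lommel_expo mu n - 2)%R)%C M.

Lemma Cppow_pred (z : C) (a : R) : 0 < Re z -> Cppow z (a - 1)%R = (Cppow z a / z)%C.
Proof.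
  intros Hz. assert (H := Cppow_minus_INR z a 1 Hz). simpl in H.
  rewrite RtoC_minus, H. field. now apply Re_pos_neq_0.
Qed.

Lemma Cppow_pred2 (z : C) (a : R) : 0 < Re z -> Cppow z (a - 2)%R = (Cppow z a / z ^ 2)%C.
Proof.
  intros Hz. assert (H := Cppow_minus_INR z a 2 Hz). simpl (INR 2) in H.
  rewrite <- H. f_equal. rewrite RtoC_minus. f_equal.
Qed.

Lemma is_Cderive_Csum (f g : nat -> C -> C) (z : C) (M : nat) :
  (forall n, is_Cderive (f n) z (g n z)) ->
  is_Cderive (fun z => Csum (fun n => f n z) M) z (Csum (fun n => g n z) M).
Proof.
  intros H. induction M as [|M IH]; simpl.
  - apply is_Cderive_const.
  - now apply is_Cderive_plus.
Qed.

Lemma is_Cderive_lommel_sum (mu nu : R) (M : nat) (z : C) : 0 < Re z ->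
  is_Cderive (lommel_sum mu nu M) z (lommel_sum1 mu nu M z).
Proof.
  intros Hz. unfold lommel_sum, lommel_sum1.
  apply (is_Cderive_Csum
    (fun n z => lommel_coef mu nu n * Cppow z (lommel_expo mu n))%C
    (fun n z => lommel_coef mu nu n * lommel_expo mu n * Cppow z (lommel_expo mu n - 1)%R)%C).
  intros n. rewrite Cppow_pred by trivial.
  replace (_ * _ * _)%C with (lommel_coef mu nu n * (lommel_expo mu n / z * Cppow z (lommel_expo mu n)))%C
    by (unfold Cdiv; ring).
  apply is_Cderive_scal. now apply is_Cderive_Cppow.
Qed.

Lemma is_Cderive_lommel_sum1 (mu nu : R) (M : nat) (z : C) : 0 < Re z ->
  is_Cderive (lommel_sum1 mu nu M) z (lommel_sum2 mu nu M z).
Proof.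
  intros Hz. unfold lommel_sum1, lommel_sum2.
  apply (is_Cderive_Csum
    (fun n z => lommel_coef mu nu n * lommel_expo mu n * Cppow z (lommel_expo mu n - 1)%R)%C
    (fun n z => lommel_coef mu nu n * lommel_expo mu n * (lommel_expo mu n - 1)%R
       * Cppow z (lommel_expo mu n - 2)%R)%C).
  intros n.
  replace (lommel_expo mu n - 2) with (lommel_expo mu n - 1 - 1) by ring.
  rewrite (Cppow_pred _ (lommel_expo mu n - 1)) by trivial.
  replace (_ * (Cppow _ _ / z))%C with (lommel_coef mu nu n * lommel_expo mu n
    * ((lommel_expo mu n - 1)%R / z * Cppow z (lommel_expo mu n - 1)%R))%C
    by (unfold Cdiv; ring).
  apply is_Cderive_scal. now apply is_Cderive_Cppow.
Qed.

(** The operator sends [z^e] to [z^e + (e^2 - nu^2) z^(e - 2)]. By the recurrence the second part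
    cancels the first part of the next term, and the sum telescopes. *)
Lemma lommel_sum_ode (mu nu : R) (M : nat) (z : C) : 0 < Re z ->
  (lommel_sum2 mu nu M z + 1 / z * lommel_sum1 mu nu M z
     + (1 - nu ^ 2 / z ^ 2) * lommel_sum mu nu M z
   = Cppow z (mu - 1)%R - lommel_coef mu nu M * Cppow z (lommel_expo mu M))%C.
Proof.
  intros Hz. assert (Hz0 := Re_pos_neq_0 z Hz).
  unfold lommel_sum, lommel_sum1, lommel_sum2. induction M as [|M IH].
  - cbn [Csum]. unfold lommel_coef, lommel_expo. simpl.
    rewrite Rminus_0_r, !Cmult_0_r, !Cplus_0_l, !Cmult_1_l. symmetry. apply Cplus_opp_r.
  - cbn [Csum]. rewrite lommel_coef_succ, Cppow_pred, Cppow_pred2 by trivial.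
    replace (lommel_expo mu (S M)) with (lommel_expo mu M - 2)
      by (unfold lommel_expo; rewrite !mult_INR, (S_INR M); simpl; ring).
    rewrite Cppow_pred2 by trivial.
    match type of IH with (?A + _ * ?B + _ * ?D = _)%C =>
      set (s2 := A) in *; set (s1 := B) in *; set (s0 := D) in * end.
    set (c := lommel_coef mu nu M) in *. set (T := Cppow z (lommel_expo mu M)) in *.
    set (e := lommel_expo mu M) in *.
    transitivity (s2 + 1 / z * s1 + (1 - nu ^ 2 / z ^ 2) * s0
      + (c * e * (e - 1)%R * (T / z ^ 2) + 1 / z * (c * e * (T / z)) + (1 - nu ^ 2 / z ^ 2) * (c * T)))%C;
      [ring|].
    rewrite IH, !RtoC_minus, !RtoC_pow. field. trivial.
Qed.

Lemma Rpower_le_pow (r e : R) (n : nat) : 1 <= r -> e <= INR n -> Rpower r e <= r ^ n.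
Proof.
  intros Hr He. rewrite <- Rpower_pow by lra.
  destruct Hr as [Hr|<-].
  - now apply Rle_Rpower; [left|].
  - unfold Rpower. rewrite ln_1, !Rmult_0_r. lra.
Qed.

Lemma lommel_sum_bound (mu nu : R) (M n : nat) : mu - 1 <= INR n ->
  exists K, forall z, 1 <= Cmod z -> Cmod (lommel_sum mu nu M z) <= K * Cmod z ^ n.
Proof.
  intros Hn. unfold lommel_sum. induction M as [|M [K IH]].
  - exists 0. intros z Hz. simpl. rewrite Cmod_0. lra.
  - exists (K + Cmod (lommel_coef mu nu M)). intros z Hz. cbn [Csum].
    apply Rle_trans with (1 := Cmod_triangle _ _). rewrite Rmult_plus_distr_r.
    apply Rplus_le_compat; [auto|]. rewrite Cmod_mult, Cmod_Cppow.
    apply Rmult_le_compat_l; [apply Cmod_ge_0|]. apply Rpower_le_pow; trivial.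
    unfold lommel_expo. generalize (pos_INR (2 * M)). lra.
Qed.

Lemma LommelS_bound (mu nu : R) (F : C -> C) (n : nat) : is_LommelS mu nu F -> mu - 1 <= INR n ->
  exists X, forall z, 0 < Re z -> X <= Cmod z -> Cmod (F z) <= 2 * Cmod z ^ n.
Proof.
  intros HF Hn. assert (HPI := PI_RGT_0).
  (* With [delta = PI / 2] the sector contains the open right half-plane; tolerance 1 gives the
     factor 2. *)
  destruct (LommelS_asympt _ _ _ HF (PI / 2) ltac:(lra) 1 Rlt_0_1) as [X HX].
  exists (Rmax 1 (X + 1)). intros z Hz HXz.
  assert (H1 := Rle_trans _ _ _ (Rmax_l _ _) HXz). assert (H2 := Rle_trans _ _ _ (Rmax_r _ _) HXz).
  specialize (HX z ltac:(lra)). cbv beta in HX.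
  assert (HX' := HX ltac:(generalize (Carg_bound z Hz); lra)). clear HX.
  rewrite <- RtoC_minus in HX'. set (T := Cppow z (mu - 1)%R) in *.
  assert (T0 : T <> 0) by apply Cppow_neq_0.
  replace (F z) with (T * ((F z / T - 1) + 1))%C by (field; trivial).
  rewrite Cmod_mult.
  assert (Cmod ((F z / T - 1) + 1) <= 2).
  { apply Rle_trans with (1 := Cmod_triangle _ _). rewrite Cmod_1. lra. }
  assert (Cmod T <= Cmod z ^ n) by (unfold T; rewrite Cmod_Cppow; now apply Rpower_le_pow).
  generalize (Cmod_ge_0 T) (Cmod_ge_0 (F z / T - 1 + 1)). nra.
Qed.

Lemma Gamma_Laplace_1_neq_0 (b : R) : 0 < b -> Gamma_Laplace b 1 <> 0.
Proof.
  intros Hb. unfold Gamma_Laplace. rewrite Laplace_sinh_RtoC. intros E.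
  apply RtoC_inj in E. revert E. apply Rgt_not_eq, Rlt_gt.
  apply RInt_0oo_exp_sinh_gt_0; [now apply exp_growth_cosh_pos_power|lra|].
  intros t Ht. apply Rmult_lt_0_compat; [apply cosh_gt_0|now apply pos_power_gt_0, sinh_gt_0].
Qed.

(** The termwise derivative of the identity between the Lommel function and its partial sum of
    [N + 1] terms corrected by a multiple of the transform of [cosh_conv]. The multiple is fixed by
    matching the leftover power of the partial sum. *)
Lemma C_derive_LommelS (N : nat) (mu nu x : R) (F : C -> C) :
  is_LommelS mu nu F -> 0 < x -> 0 < 2 * INR N + 1 - mu ->
  let b := 2 * INR N + 1 - mu in
  C_derive F x = (lommel_sum1 mu nu (S N) x
    - lommel_coef mu nu (S N) / Gamma_Laplace b 1
      * Laplace_sinh (fun t => sinh t * cosh_conv b nu t)%R x)%C.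
Proof.
  intros HF Hx Hb b. fold b in Hb.
  assert (G0 := Gamma_Laplace_1_neq_0 b Hb).
  assert (Gi := exp_growth_cosh_conv b nu Hb).
  assert (Gsi : exp_growth (fun t => sinh t * cosh_conv b nu t))
    by (apply exp_growth_mult; [apply exp_growth_sinh|trivial]).
  set (c := (lommel_coef mu nu (S N) / Gamma_Laplace b 1)%C).
  pose (h := fun z => (F z - lommel_sum mu nu (S N) z - c * Laplace_sinh (cosh_conv b nu) z)%C).
  pose (h1 := fun z => (C_derive F z - lommel_sum1 mu nu (S N) z
    - c * - Laplace_sinh (fun t => sinh t * cosh_conv b nu t)%R z)%C).
  pose (h2 := fun z => (C_derive (C_derive F) z - lommel_sum2 mu nu (S N) z
    - c * - - Laplace_sinh (fun t => sinh t * (sinh t * cosh_conv b nu t))%R z)%C).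
  enough (E : h1 x = 0).
  { unfold h1 in E. apply (f_equal (fun w => w + (lommel_sum1 mu nu (S N) x
      - c * Laplace_sinh (fun t => sinh t * cosh_conv b nu t)%R x))%C) in E.
    ring_simplify in E. rewrite E. ring. }
  destruct (INR_unbounded (mu - 1)) as [n Hn]. apply Rlt_le in Hn.
  destruct (lommel_sum_bound mu nu (S N) n Hn) as [K1 B1].
  destruct (LommelS_bound mu nu F n HF Hn) as [X B2].
  destruct (Laplace_sinh_bounded _ 1 Gi Rlt_0_1) as (K2 & PK2 & B3).
  apply (bessel_unique nu h h1 h2 (Rmax 1 X) (2 + K1 + Cmod c * K2) n); trivial.
  - intros z Hz. apply is_Cderive_minus; [apply is_Cderive_minus|apply is_Cderive_scal].
    + apply Cderivable_is_Cderive, (LommelS_derivable _ _ _ HF), Re_pos_slit_plane, Hz.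
    + now apply is_Cderive_lommel_sum.
    + now apply is_Cderive_Laplace_sinh.
  - intros z Hz. apply is_Cderive_minus; [apply is_Cderive_minus|apply is_Cderive_scal].
    + apply Cderivable_is_Cderive, (LommelS_derivable2 _ _ _ HF), Re_pos_slit_plane, Hz.
    + now apply is_Cderive_lommel_sum1.
    + apply is_Cderive_ext with
        (fun z => (- 1) * Laplace_sinh (fun t => sinh t * cosh_conv b nu t)%R z)%C; [intros; ring|].
      replace (- - Laplace_sinh (fun t => sinh t * (sinh t * cosh_conv b nu t))%R z)%C
        with ((- 1) * - Laplace_sinh (fun t => sinh t * (sinh t * cosh_conv b nu t))%R z)%C by ring.
      apply is_Cderive_scal. now apply is_Cderive_Laplace_sinh.
  - intros z Hz. assert (Hz0 := Re_pos_neq_0 z Hz).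
    assert (O1 := LommelS_ode _ _ _ HF z (Re_pos_slit_plane z Hz)).
    assert (O2 := lommel_sum_ode mu nu (S N) z Hz).
    assert (O3 := Laplace_cosh_conv_ode b nu z Hb Hz).
    (* The source term [Gamma_Laplace b z / z] is a multiple of [z^(- b - 2)], and [- b - 2] is the
       exponent of index [N + 1] left by the telescoping. *)
    rewrite (Gamma_Laplace_Cppow b z) in O3 by trivial.
    replace (- b - 1)%C with (RtoC (lommel_expo mu (S N) + 1)) in O3.
    2: { rewrite <- RtoC_opp, <- RtoC_minus. f_equal. unfold lommel_expo, b.
         rewrite mult_INR, (S_INR N). simpl. ring. }
    assert (O4 := Cppow_pred z (lommel_expo mu (S N) + 1) Hz).
    replace (lommel_expo mu (S N) + 1 - 1) with (lommel_expo mu (S N)) in O4 by ring.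
    rewrite <- RtoC_minus in O1.
    unfold h, h1, h2.
    set (q := (1 - nu ^ 2 / z ^ 2)%C) in *.
    transitivity ((C_derive (C_derive F) z + 1 / z * C_derive F z + q * F z)
      - (lommel_sum2 mu nu (S N) z + 1 / z * lommel_sum1 mu nu (S N) z + q * lommel_sum mu nu (S N) z)
      - c * (Laplace_sinh (fun t => sinh t * (sinh t * cosh_conv b nu t))%R z
         + 1 / z * - Laplace_sinh (fun t => sinh t * cosh_conv b nu t)%R z
         + q * Laplace_sinh (cosh_conv b nu) z))%C; [ring|].
    rewrite O1, O2, O3, O4. unfold c. field. split; trivial.
  - intros z Hz.
    assert (Z1 := Rle_trans _ _ _ (Rmax_l _ _) Hz). assert (Z2 := Rle_trans _ _ _ (Rmax_r _ _) Hz).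
    assert (L := re_le_Cmod z). rewrite Rabs_pos_eq in L by lra.
    assert (P1 : 1 <= Cmod z ^ n) by (apply pow_R1_Rle; lra).
    unfold h, Cminus. rewrite !Rmult_plus_distr_r.
    apply Rle_trans with (1 := Cmod_triangle _ _). apply Rplus_le_compat.
    + apply Rle_trans with (1 := Cmod_triangle _ _). rewrite Cmod_opp. apply Rplus_le_compat.
      * apply B2; lra.
      * apply B1; lra.
    + rewrite Cmod_opp, Cmod_mult, Rmult_assoc.
      apply Rmult_le_compat_l; [apply Cmod_ge_0|].
      specialize (B3 z Z1). nra.
Qed.

(** * The expansion of the derivative and the factor [theta] *)

Lemma lommel_b_coef (mu nu : R) (n : nat) :
  ((-1) ^ n * lommel_b (- mu) nu n = lommel_coef mu nu n * lommel_expo mu n)%C.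
Proof.
  unfold lommel_b, lommel_coef, lommel_expo. rewrite mult_INR. simpl (INR 2).
  rewrite !RtoC_minus, RtoC_mult, RtoC_plus. ring.
Qed.

Lemma Cppow_lommel_expo (mu : R) (n : nat) (z : C) : 0 < Re z ->
  Cppow z (lommel_expo mu n - 1)%R = (Cppow z (mu - 2) / z ^ (2 * n))%C.
Proof.
  intros Hz. rewrite <- Cppow_minus_INR by trivial. f_equal.
  unfold lommel_expo. rewrite !RtoC_minus. ring.
Qed.

Lemma lommel_sum1_Csum (mu nu : R) (M : nat) (z : C) : 0 < Re z ->
  lommel_sum1 mu nu M z
  = (Cppow z (mu - 2) * Csum (fun n => (-1) ^ n * (lommel_b (- mu) nu n / z ^ (2 * n))) M)%C.
Proof.
  intros Hz. unfold lommel_sum1. induction M as [|M IH]; cbn [Csum]; [ring|].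
  rewrite IH, Cppow_lommel_expo, <- lommel_b_coef by trivial. unfold Cdiv. ring.
Qed.

Theorem theorem1p5 (N : nat) (z mu nu : R) (hz : (0 < z)%R)
  (hmunu : (mu + Rabs nu < 2 * INR N + 1)%R)
  (S : C -> C) (hS : is_LommelS (RtoC mu) (RtoC nu) S) :
  exists theta : R, (0 < theta < 1)%R /\
    LommelS'_rem S N (RtoC z) (RtoC mu) (RtoC nu) =
      ((-1) ^ N * (lommel_b (- RtoC mu) (RtoC nu) N / RtoC z ^ (2 * N))
        * RtoC theta)%C.
Proof.
  assert (Hn := Rabs_pos nu).
  assert (Hb : 0 < 2 * INR N + 1 - mu) by lra.
  assert (HS := C_derive_LommelS N mu nu z S hS hz Hb). cbv zeta in HS.
  set (b := 2 * INR N + 1 - mu) in *.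
  assert (Hbn : nu ^ 2 < b ^ 2) by (rewrite <- (pow2_abs nu); unfold b; nra).
  assert (Gi := exp_growth_cosh_conv b nu Hb).
  assert (Gsi : exp_growth (fun t => sinh t * cosh_conv b nu t))
    by (apply exp_growth_mult; [apply exp_growth_sinh|trivial]).
  assert (Gp := exp_growth_cosh_pos_power b Hb).
  pose (J1 := RInt_0oo (fun t => exp (- (z * sinh t)) * (cosh t * pos_power b (sinh t)))).
  pose (J2 := RInt_0oo (fun t => exp (- (z * sinh t)) * (sinh t * cosh_conv b nu t))).
  assert (P1 : 0 < J1).
  { apply RInt_0oo_exp_sinh_gt_0; trivial. intros t Ht.
    apply Rmult_lt_0_compat; [apply cosh_gt_0|now apply pos_power_gt_0, sinh_gt_0]. }
  assert (P2 : 0 < J2).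
  { apply RInt_0oo_exp_sinh_gt_0; trivial. intros t Ht.
    apply Rmult_lt_0_compat; [now apply sinh_gt_0|now apply cosh_conv_gt_0]. }
  assert (P3 : (b ^ 2 - nu ^ 2) * J2 < b * J1).
  { assert (H := RInt_0oo_exp_sinh_gt_0 (fun t => b * (cosh t * pos_power b (sinh t))
      + - (b ^ 2 - nu ^ 2) * (sinh t * cosh_conv b nu t)) z).
    rewrite (RInt_0oo_ext _ (fun t => b * (exp (- (z * sinh t)) * (cosh t * pos_power b (sinh t)))
      + - (b ^ 2 - nu ^ 2) * (exp (- (z * sinh t)) * (sinh t * cosh_conv b nu t)))) in H
      by (intros; ring).
    assert (E1 := exp_dominated_exp_sinh _ z Gp hz). cbv beta in E1.
    assert (E2 := exp_dominated_exp_sinh _ z Gsi hz). cbv beta in E2.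
    rewrite RInt_0oo_plus, !RInt_0oo_scal in H by (trivial; now apply exp_dominated_scal).
    fold J1 in H. fold J2 in H.
    enough (0 < b * J1 + - (b ^ 2 - nu ^ 2) * J2) by lra.
    apply H; trivial.
    - apply exp_growth_plus; apply exp_growth_mult; trivial; apply exp_growth_const.
    - intros t Ht. generalize (cosh_conv_lt b nu t Hb Ht). lra. }
  exists (1 - (b ^ 2 - nu ^ 2) * J2 / (b * J1)).
  assert (P4 : 0 < b * J1) by now apply Rmult_lt_0_compat.
  split.
  { assert (0 < (b ^ 2 - nu ^ 2) * J2 / (b * J1)).
    { apply Rdiv_lt_0_compat; trivial. apply Rmult_lt_0_compat; lra. }
    assert ((b ^ 2 - nu ^ 2) * J2 / (b * J1) < 1).
    { apply Rmult_lt_reg_r with (b * J1); trivial. unfold Rdiv.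
      rewrite Rmult_assoc, Rinv_l; lra. }
    lra. }
  assert (Pz : 0 < Re z) by exact hz.
  assert (Hz0 : RtoC z <> 0) by now apply Re_pos_neq_0.
  assert (G0 := Gamma_Laplace_1_neq_0 b Hb).
  assert (T0 := Cppow_neq_0 z (mu - 2)).
  assert (Eb : lommel_expo mu N = - b).
  { unfold lommel_expo, b. rewrite mult_INR. simpl. ring. }
  (* The power in the term of index [N] is [z^(- b - 1)], so the Gamma factor and this power
     recombine into the real integral [J1]. *)
  assert (EJ : (Gamma_Laplace b 1 * (Cppow z (mu - 2) / z ^ (2 * N)) = J1)%C).
  { rewrite <- Cppow_lommel_expo, Eb, RtoC_minus, RtoC_opp by trivial.
    rewrite <- Gamma_Laplace_Cppow by trivial. apply Laplace_sinh_RtoC. }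
  unfold LommelS'_rem. rewrite HS, lommel_sum1_Csum, Laplace_sinh_RtoC by trivial. fold J2.
  (* The last of the [N + 1] terms yields the 1 in [theta]. The integral carries the coefficient of
     index [N + 1], which is [- (b^2 - nu^2)] times that of index [N], so the latter factors out. *)
  cbn [Csum]. rewrite lommel_coef_succ, Eb.
  assert (W0 : (z ^ (2 * N))%C <> 0) by now apply Cpow_nz.
  set (W := (z ^ (2 * N))%C) in *. set (T := Cppow z (mu - 2)) in *.
  set (G := Gamma_Laplace b 1) in *.
  replace ((-1) ^ N * (lommel_b (- mu) nu N / W))%C with (lommel_coef mu nu N * - b / W)%C
    by (unfold Cdiv; rewrite Cmult_assoc, lommel_b_coef, Eb, RtoC_opp; reflexivity).
  assert (B0 : RtoC b <> 0) by now apply Re_pos_neq_0.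
  replace ((- b) ^ 2 - nu ^ 2) with (b ^ 2 - nu ^ 2) by ring.
  set (k := b ^ 2 - nu ^ 2).
  rewrite RtoC_minus, RtoC_div, !RtoC_mult, <- EJ by lra.
  field. repeat split; trivial.
Qed.
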